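(* Let $\mathbf{G}=(J,\mathcal{B},E,\lambda)$ be a graphing with edge measure $\eta$, and for Borel sets $X\subseteq E$ let $$\rho(X)=1-\mathsf{E}\Big(\frac{1}{|V(\mathbf{G}^X_{\mathbf{u}})|}\Big),$$ where $\mathbf{u}$ is a random point of $J$ with distribution $\lambda$ and $V(\mathbf{G}^X_u)$ is the node set of the connected component of the graph $(J,X)$ containing $u$ (with $1/\infty=0$). Then the setfunction $\rho$, defined on the Borel subsets of $E$, is increasing and submodular. In addition, $\rho$ is strongly bounded, continuous from above, and absolutely continuous with respect to the measure $\eta$.
   Context: A graphing is a quadruple $\mathbf{G}=(J,\mathcal{B},E,\lambda)$, where $(J,\mathcal{B})$ is a standard Borel space, $\lambda$ is a probability measure on $\mathcal{B}$, and $E$ is a Borel set of unordered pairs of distinct points of $J$ (identified with a symmetric Borel subset of $J\times J$ disjoint from the diagonal), such that all degrees of the graph $(J,E)$ are bounded by a finite integer $D\ge 0$ and $$\int_A \deg_B(x)\,d\lambda(x)=\int_B \deg_A(x)\,d\lambda(x)\qquad\text{for all }A,B\in\mathcal{B},$$ where $\deg_B(x)$ is the number of edges from $x$ to points of $B$. Borel subsets $X\subseteq E$ are sets of (unordered) edges, i.e. they are identified with symmetric Borel subsets of $J\times J$. For every Borel $X\subseteq E$, $\mathbf{G}^X=(J,\mathcal{B},X,\lambda)$ is again a graphing. The average degree is $\overline{d}=\int_J\deg(u)\,d\lambda(u)$, assumed positive so that the edge measure is defined. The edge measure $\eta$ is the probability measure on $\mathcal{B}\times\mathcal{B}$ (the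 product sigma-algebra) extending $\eta(A\times B)=\frac{1}{\overline{d}}\int_A\deg_B(x)\,d\lambda(x)$; it is symmetric, supported on $E$, and satisfies $\eta(X)=\frac1{\overline d}\int_J\deg_X(u)\,d\lambda(u)$ for Borel $X\subseteq E$, where $\deg_X(u)$ is the number of edges of $X$ incident with $u$. For a nonnegative setfunction $\varphi$ defined on a sigma-algebra (here, on the Borel subsets of $E$): - $\varphi$ is increasing if $X\subseteq Y$ implies $\varphi(X)\le\varphi(Y)$; - $\varphi$ is submodular if $\varphi(X\cup Y)+\varphi(X\cap Y)\le\varphi(X)+\varphi(Y)$ for all $X,Y$; - $\varphi$ is strongly bounded if there is a finite measure $\alpha$ such that $\varphi\le\alpha$; - $\varphi$ is continuous from above if for every sequence $A_1\supseteq A_2\supseteq\dots$ of sets in the sigma-algebra, with $A=\bigcap_i A_i$, we have $\varphi(A_n)\to\varphi(A)$ as $n\to\infty$; - $\varphi$ is absolutely continuous with respect to a measure $\pi$ if for every $\varepsilon>0$ there is a $\delta>0$ such that $\pi(S)<\delta$ implies $|\varphi(S)|<\varepsilon$ for every $S$ in the sigma-algebra. *)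

(* Defs.v *)
From HB Require Import structures.
From mathcomp Require Import all_boot all_order all_algebra finmap.
From mathcomp Require Import all_classical all_reals all_analysis.

Set Implicit Arguments.
Unset Strict Implicit.
Unset Printing Implicit Defensive.

Import Order.TTheory GRing.Theory Num.Theory.
Import numFieldNormedType.Exports.

Local Open Scope classical_set_scope.
Local Open Scope ring_scope.

(* [T] with its metric is Polish; [f] identifies the measurable sets of [J]
   with the Borel sets of [T]. *)
Definition standard_borel (R : realType) (d : measure_display)
    (J : measurableType d) : Prop :=
  exists (T : metricType R) (f : J -> T),
    [/\ forall F : set_system T, ProperFilter F -> cauchy F ->
          exists x : T, F --> x,
        exists2 S : set T, countable S & dense S,
        bijective f
      & forall A : set J, measurable A <-> <<s @open T >> (f @` A)].

Definition symmetric_set (J : Type) (X : set (J * J)) : Prop :=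
  forall x y, X (x, y) -> X (y, x).

(* [deg R E B x] is deg_B(x), the number of edges from [x] to points of [B]. *)
Definition deg (R : realType) (J : choiceType) (E : set (J * J)) (B : set J)
    (x : J) : \bar R :=
  counting [set y | B y /\ E (x, y)].

(* The integrals need no separate measurability hypothesis on degrees: since
   [E] is Borel with finite sections in a standard Borel space, [deg R E B] is
   Borel for every Borel [B] (Lusin-Novikov). *)
Record graphing (R : realType) (d : measure_display) (J : measurableType d)
    (lambda : probability J R) (E : set (J * J)) : Prop := Graphing {
  graphing_standard_borel : standard_borel R J ;
  graphing_measurable : measurable E ;
  graphing_sym : symmetric_set E ;
  graphing_irrefl : forall x, ~ E (x, x) ;
  graphing_bounded_degree :
    exists D : nat, forall x, (deg R E setT x <= D%:R%:E)%E ;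
  graphing_measure_preserving : forall A B : set J,
    measurable A -> measurable B ->
    (\int[lambda]_(x in A) deg R E B x = \int[lambda]_(x in B) deg R E A x)%E
}.

Definition average_degree (R : realType) (d : measure_display)
    (J : measurableType d) (lambda : probability J R) (E : set (J * J)) :
    \bar R :=
  (\int[lambda]_u deg R E setT u)%E.

Definition edge_measure (R : realType) (d : measure_display)
    (J : measurableType d) (lambda : probability J R) (E : set (J * J))
    (eta : probability (J * J)%type R) : Prop :=
  forall A B : set J, measurable A -> measurable B ->
    (eta (A `*` B) =
     (average_degree lambda E)^-1 * \int[lambda]_(x in A) deg R E B x)%E.

(* Sets of unordered edges, as symmetric sets of ordered pairs. *)
Definition borel_edge_sets (d : measure_display) (J : measurableType d)
    (E : set (J * J)) : set (set (J * J)) :=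
  [set X | [/\ measurable X, X `<=` E & symmetric_set X]].

Definition component (J : Type) (X : set (J * J)) (u : J) : set J :=
  [set v | exists2 p : seq J, path (fun x y => `[< X (x, y) >]) u p
                            & last u p = v].

(* [counting] is +oo on infinite sets, and +oo^-1 = 0 in [\bar R]. *)
Definition rho (R : realType) (d : measure_display) (J : measurableType d)
    (lambda : probability J R) (X : set (J * J)) : R :=
  1 - fine 'E_lambda[fun u => fine ((counting (component X u) : \bar R)^-1)%E].

(* In the following definitions [phi] is a setfunction on the sigma-algebra
   [F], a family of measurable sets of [T]; its values off [F] are ignored. *)

Definition increasing_on (R : realType) (T : Type) (F : set (set T))
    (phi : set T -> R) : Prop :=
  forall X Y, F X -> F Y -> X `<=` Y -> phi X <= phi Y.

Definition submodular_on (R : realType) (T : Type) (F : set (set T))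
    (phi : set T -> R) : Prop :=
  forall X Y, F X -> F Y ->
    phi (X `|` Y) + phi (X `&` Y) <= phi X + phi Y.

Definition strongly_bounded_on (R : realType) (d : measure_display)
    (T : measurableType d) (F : set (set T)) (phi : set T -> R) : Prop :=
  exists alpha : {finite_measure set T -> \bar R},
    forall X, F X -> ((phi X)%:E <= alpha X)%E.

Definition continuous_from_above_on (R : realType) (T : Type)
    (F : set (set T)) (phi : set T -> R) : Prop :=
  forall A : nat -> set T, (forall n, F (A n)) ->
    (forall n, A n.+1 `<=` A n) ->
    phi (A n) @[n --> \oo] --> phi (\bigcap_n A n).

Definition absolutely_continuous_on (R : realType) (T : Type)
    (F : set (set T)) (phi : set T -> R) (nu : set T -> \bar R) : Prop :=
  forall eps : R, 0 < eps -> exists2 delta : R, 0 < delta &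
    forall S, F S -> (nu S < delta%:E)%E -> `|phi S| < eps.

(* Main.v *)
Require Import Defs.
From HB Require Import structures.
From mathcomp Require Import all_boot all_order all_algebra finmap.
From mathcomp Require Import all_classical all_reals all_analysis.
From mathcomp Require Import measurable_realfun lra zify.

(* For bounded sections, the Lusin-Novikov theorem (a Borel set with countable
   sections is covered by countably many graphs of Borel functions) follows from
   Novikov's separation of projections of Borel sets. It decomposes the edge set
   into countably many measure-preserving partial bijections, whence the mass
   transport principle on the components of the graph, and the measurability of
   everything in sight.

   Submodularity. Fix [k] and replace [1/|V|] by [1/min(k,|V|)], which equals
   [max(1/|V|,1/k)]. Let [M] be a set of pairwise far apart edges [xy], and let
   [a], [b] be the sizes, truncated at [k], of the components of [x] and [y] in
   [X]. Adding [M] to [X] changes the components of size less than [k] only by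
   merging them along single edges of [M], so that the sum of [1/min(k,|V|)] over
   the vertices affected by [xy] drops by [2 - (a+b)/min(a+b,k)] (by [0] if [x]
   and [y] were already connected). This is smaller for larger [X], so by mass
   transport the expectation of [1/min(k,|V|)] drops less on top of more edges.
   The graph being of bounded degree, [Y] is a countable union of such sets [M];
   adding them one by one to [X] and to [X & Y], and then letting [k] tend to
   infinity, gives submodularity.

   The remaining claims follow from monotonicity, submodularity and
   [rho X <= lambda {u | deg_X u > 0} <= average_degree * eta X]. *)

Set Implicit Arguments.
Unset Strict Implicit.
Unset Printing Implicit Defensive.

Import Order.TTheory GRing.Theory Num.Theory.
Import numFieldNormedType.Exports.

Local Open Scope classical_set_scope.

(** * Polish structure of a standard Borel space *)

Section measurable_predicates.
Context (d : measure_display) (T : measurableType d).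

Lemma measurable_cstP (P : Prop) : measurable [set _ : T | P].
Proof.
have [p|np] := pselect P.
  by rewrite (_ : [set _ | _] = setT)//; apply/seteqP; split.
by rewrite (_ : [set _ | _] = set0)//; apply/seteqP; split.
Qed.

Lemma measurable_neg (P : T -> Prop) :
  measurable [set x | P x] -> measurable [set x | ~ P x].
Proof. exact: measurableC. Qed.

Lemma measurable_conj (P Q : T -> Prop) : measurable [set x | P x] ->
  measurable [set x | Q x] -> measurable [set x | P x /\ Q x].
Proof. exact: measurableI. Qed.

Lemma measurable_disj (P Q : T -> Prop) : measurable [set x | P x] ->
  measurable [set x | Q x] -> measurable [set x | P x \/ Q x].
Proof. exact: measurableU. Qed.

Lemma measurable_exists (I : countType) (P : I -> T -> Prop) :
  (forall i, measurable [set x | P i x]) ->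
  measurable [set x | exists i, P i x].
Proof.
move=> mP; rewrite (_ : [set x | _] = \bigcup_i [set x | P i x]).
  by apply: countable_bigcupT_measurable; [exact: countableP|exact: mP].
by apply/seteqP; split => x [i] => [Pi|_ Pi]; exists i.
Qed.

Lemma measurable_forall (I : countType) (P : I -> T -> Prop) :
  (forall i, measurable [set x | P i x]) ->
  measurable [set x | forall i, P i x].
Proof.
move=> mP; rewrite (_ : [set x | _] = ~` [set x | exists i, ~ P i x]).
  by apply: measurableC; apply: measurable_exists => i; exact: measurableC (mP i).
apply/seteqP; split => x /= => [Px [i nPi]|Px i]; first exact/nPi/Px.
by apply: contrapT => nPi; apply: Px; exists i.
Qed.

Lemma measurable_impl (P Q : T -> Prop) : measurable [set x | P x] ->
  measurable [set x | Q x] -> measurable [set x | P x -> Q x].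
Proof.
move=> mP mQ; rewrite (_ : [set x | _] = ~` [set x | P x] `|` [set x | Q x]).
  by apply: measurableU => //; exact: measurableC.
apply/seteqP; split => x /=; last by case.
by move=> PQ; have [/PQ|] := pselect (P x); [right|left].
Qed.

Lemma measurable_preimage d' (T' : measurableType d') (f : T -> T')
    (A : set T') : measurable_fun setT f -> measurable A ->
  measurable [set x | A (f x)].
Proof. by move=> mf mA; rewrite -[X in measurable X]setTI; exact: mf. Qed.

End measurable_predicates.

Section sigma_algebra_induction.
Context (T : Type).

Lemma sigma_algebra_ind (G : set (set T)) (P : set T -> Prop) :
  (forall A, G A -> P A) -> P set0 -> (forall A, P A -> P (~` A)) ->
  (forall F : (set T)^nat, (forall n, P (F n)) -> P (\bigcup_n F n)) ->
  forall A, <<s G >> A -> P A.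
Proof.
move=> GP P0 PC PU; apply: smallest_sub => //; split => //.
by move=> A PA; rewrite setTD; exact: PC.
Qed.

End sigma_algebra_induction.

(* A Polish metric, recorded by the relations [cl n x y] standing for
   [d(x, y) <= 2^-n] and a dense sequence [q]. *)
Record polish (d : measure_display) (J : measurableType d)
    (cl : nat -> J -> J -> Prop) (q : nat -> J) : Prop := Polish {
  cl_refl : forall n x, cl n x x ;
  cl_sym : forall n x y, cl n x y -> cl n y x ;
  cl_tri : forall n y x z, cl n.+1 x y -> cl n.+1 y z -> cl n x z ;
  cl_sep : forall x y, (forall n, cl n x y) -> x = y ;
  cl_closed : forall k y x, (forall n, exists2 z, cl n z x & cl k y z) ->
    cl k y x ;
  cl_dense : forall n x, exists i, cl n (q i) x ;
  cl_complete : forall u, (forall n, cl n (u n) (u n.+1)) ->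
    exists x, forall n, cl n (u n.+1) x ;
  cl_measurable : forall n i, measurable [set y | cl n (q i) y] ;
  cl_generate : forall A, measurable A ->
    <<s [set B | exists n i, B = [set y | cl n (q i) y]] >> A }.

Section standard_borel_polish.
Local Open Scope ring_scope.
Context (R : realType) (d : measure_display) (J : measurableType d).

(** The metric is pulled back along [f], with [cl n x y] meaning distance at most [2^-n]. Every open
    set is a union of closed balls about points of the dense sequence, so these countably many balls
    generate the Borel sets. *)
Lemma standard_borel_polish (j0 : J) : standard_borel R J ->
  exists cl q, @polish d J cl q.
Proof.
move=> [T [f [cT [S cS dS] [g fK gK] mJ]]].
pose e n : R := 2^-1 ^+ n.
have e0 n : 0 < e n by rewrite exprn_gt0 ?invr_gt0.
have eS n : e n.+1 + e n.+1 = e n.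
  by rewrite /e exprS; lra.
have ecvg r : 0 < r -> exists n, e n < r.
  move=> r0; have : (fun n => e n) @ \oo --> (0 : R).
    by apply: cvg_expr; rewrite ger0_norm ?invr_ge0// invf_lt1// ltr1n.
  move=> /cvgrPdist_lt /(_ _ r0) [n _ /(_ n (leqnn n))].
  by rewrite sub0r normrN gtr0_norm//; exists n.
pose D x y : R := mdist (f x) (f y).
have DC x y : D x y = D y x by exact: metric_sym.
have Dt y x z : D x z <= D x y + D y z by exact: metric_triangle.
have Dxx x : D x x = 0 by exact: mdistxx.
have openP (O : set T) : open O <->
    forall x, O (f x) -> exists n, forall y, D x y <= e n -> O (f y).
  rewrite openE; split => [Oo x /Oo/nbhs_ballP[r /= r0 rO]|Oo x Ox].
    have [n nr] := ecvg _ r0; exists n => y xy; apply: rO.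
    by rewrite ballEmdist/=; exact: le_lt_trans nr.
  have [n nO] : exists n, forall y, D (g x) y <= e n -> O (f y).
    by apply: Oo; rewrite gK.
  apply/nbhs_ballP; exists (e n) => //= y; rewrite ballEmdist/= => xy.
  by rewrite -(gK y); apply: nO; rewrite /D !gK ltW.
have [h hinj] := countable_injP _ cS.
(* [q i] is the point of [S] with code [i] under the injection [h], and the default [j0] if there is
   none. *)
have [q qd] : exists q : nat -> J, forall n x, exists i, D (q i) x <= e n.
  exists (fun i => xget j0 [set x | S (f x) /\ h (f x) = i]) => n x.
  have [||y [xy Sy]] := dS [set y | mdist (f x) y < e n].
  - by exists (f x); rewrite /= mdistxx.
  - apply/openP => y /= xy; have [|m mxy] := ecvg (e n - D x y).
      by rewrite subr_gt0.
    exists m => z yz; apply: le_lt_trans (Dt y _ _) _.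
    by rewrite addrC -ltrBrDr; exact: le_lt_trans mxy.
  exists (h y); have /(xgetPex j0) : exists x, [set x | S (f x) /\ h (f x) = h y] x.
    by exists (g y); rewrite /= gK.
  rewrite /=; set z := xget _ _ => -[Sz hz].
  suff -> : z = g y by rewrite DC /D gK; exact: ltW.
  by rewrite -[LHS]fK (hinj _ _ _ _ hz)// inE.
have mball n i : measurable [set y | D (q i) y <= e n].
  rewrite -[X in measurable X]setCK; apply: measurableC; apply/mJ.
  apply: sub_sigma_algebra; apply/openP => y [x /= xn /(can_inj fK) xy].
  have {xn} : e n < D (q i) y by rewrite -xy ltNge; exact/negP.
  rewrite -subr_gt0 => /ecvg[m mn]; exists m => z yz; exists z => //=.
  apply/negP; rewrite -ltNge; move: mn; rewrite ltrBrDr => mn.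
  rewrite -(ltrD2l (e m)); apply: lt_le_trans mn _; rewrite (le_trans (Dt z _ _))//.
  by rewrite addrC lerD2r DC.
exists (fun n x y => D x y <= e n), q; split => //.
- by move=> n x; rewrite Dxx ltW.
- by move=> n x y; rewrite DC.
- move=> n y x z xy yz; rewrite -eS; apply: le_trans (Dt y _ _) _.
  exact: lerD.
- move=> x y xy; apply: (can_inj fK); apply: mdist_positivity.
  apply/eqP; rewrite eq_le mdist_ge0 andbT leNgt; apply/negP => /ecvg[n].
  by rewrite ltNge xy.
- move=> k y x H; apply/ler_addgt0Pr => r /ecvg[n nr].
  have [z xz yz] := H n; apply: le_trans (Dt z _ _) _.
  by apply: lerD => //; apply: le_trans xz (ltW nr).
- move=> u uS.
  (* The bound is the geometric sum of the [e j] for [n <= j < n + m]. *)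
  have uD n m : D (u n) (u (n + m)%N) <= 2 * e n - 2 * e (n + m)%N.
    elim: m => [|m IH]; first by rewrite addn0 Dxx subrr.
    apply: le_trans (Dt (u (n + m)%N) _ _) _; apply: le_trans (lerD IH _) _.
      by rewrite addnS; exact: uS.
    rewrite addnS -(eS (n + m)%N); lra.
  have uD2 n m : (n.+1 <= m)%N -> D (u n.+1) (u m) <= e n.
    move=> nm; rewrite -(subnKC nm); apply: le_trans (uD _ _) _.
    by have := eS n; have := e0 (n.+1 + (m - n.+1))%N; lra.
  have [x ux] : exists x : T, f (u n) @[n --> \oo] --> x.
    apply: cT; apply: cauchy_exP => r r0; have [n nr] := ecvg _ r0.
    exists (f (u n.+1)); exists n.+1 => //= m /= nm.
    by rewrite ballEmdist/=; apply: le_lt_trans (uD2 _ _ nm) nr.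
  exists (g x) => n; apply/ler_addgt0Pr => r r0.
  have /cvg_ballP/(_ _ r0)[N _ /= Nu] := ux.
  apply: le_trans (Dt (u (maxn N n.+1)) _ _) _; apply: lerD.
    by apply: uD2; rewrite leq_maxr.
  have := Nu (maxn N n.+1) (leq_maxl _ _).
  by rewrite ballEmdist/= => /ltW; rewrite DC /D gK.
- move=> A mA; have {}mA := (mJ _).1 mA.
  set G := <<s _ >>; pose P B := G (f @^-1` B).
  have -> : A = f @^-1` (f @` A).
    by apply/seteqP; split=> x /= => [Ax|[y Ay /(can_inj fK)<-//]]; exists x.
  apply: (@sigma_algebra_ind _ open P _ _ _ _ _ mA) => [U /openP Oo| |B PB|F PF].
  - rewrite /P (_ : _ @^-1` _ = \bigcup_n \bigcup_(i in
        [set i | forall y, D (q i) y <= e n -> U (f y)]) [set y | D (q i) y <= e n]).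
      apply: sigma_algebra_bigcup => n; rewrite bigcup_mkcond.
      apply: sigma_algebra_bigcup => i; case: ifPn => _; last exact: sigma_algebra0.
      by apply: sub_sigma_algebra; exists n, i.
    apply/seteqP; split => [x /= Ox|x [n _ [i /= iO]]]; last exact: iO.
    have [n nO] := Oo _ Ox; have [i ix] := qd n.+1 x.
    exists n.+1 => //; exists i => //= y iy; apply: nO.
    apply: le_trans (Dt (q i) _ _) _.
    by rewrite -(eS n) lerD// DC.
  - by rewrite /P preimage_set0; exact: sigma_algebra0.
  - by rewrite /P preimage_setC -setTD; exact: sigma_algebraCD.
  - by rewrite /P preimage_bigcup; exact: sigma_algebra_bigcup.
Qed.

End standard_borel_polish.

(** * Souslin sets *)

Section polish_theory.
Context (d : measure_display) (J : measurableType d).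
Context (cl : nat -> J -> J -> Prop) (q : nat -> J) (P : polish cl q).

Lemma cl_le m n x y : m <= n -> cl n x y -> cl m x y.
Proof.
move=> /subnKC <-; elim: (n - m) => [|k IH]; first by rewrite addn0.
by rewrite addnS => xy; apply/IH/(cl_tri P xy)/(cl_refl P).
Qed.

(** Finitely many of these balls always have a common point, so consecutive centres are close and
    the centres converge; the balls being closed, the limit lies in all of them. *)
Lemma cl_nested (c : nat -> J) :
  (forall m, exists z, forall k, k < m -> cl k (c k) z) ->
  exists z, forall k, cl k (c k) z.
Proof.
move=> /choice[z cz].
have [x cx] : exists x, forall n, cl n (c n.+2) x.
  apply: (cl_complete P (u := fun n => c n.+1)) => n.
  apply: (@cl_tri _ _ _ _ P n (z n.+3)); first by apply: cz; lia.
  by apply: (cl_sym P); apply: (@cl_le _ n.+2) => //; apply: cz; lia.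
exists x => k; apply: (cl_closed P) => n; pose m := maxn k n.+3.
exists (z m.+1); last by apply: cz; rewrite ltnS leq_maxl.
apply: (@cl_tri _ _ _ _ P n (c n.+3)); last exact: cx.
apply: (cl_sym P); apply: (@cl_le _ n.+3); first lia.
by apply: cz; rewrite ltnS leq_maxr.
Qed.

(** Two points agree as soon as every ball about some [q i] that contains the first contains the
    second, which is a countable condition. *)
Lemma measurable_diag : measurable [set p : J * J | p.1 = p.2].
Proof.
rewrite (_ : [set p | _] = [set p | forall ni : nat * nat,
    cl ni.1 (q ni.2) p.1 -> cl ni.1 (q ni.2) p.2]).
  have mb f n i : measurable_fun setT f ->
      measurable [set p : J * J | cl n (q i) (f p)].
    by move=> mf; apply: (measurable_preimage mf); exact: (cl_measurable P).
  apply: measurable_forall => ni; apply: measurable_impl; apply: mb.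
    exact: measurable_fst.
  exact: measurable_snd.
apply/seteqP; split => -[x y] /= => [-> //|H]; apply: (cl_sep P) => n.
have [i ix] := cl_dense P n.+1 x.
by apply: (cl_tri P) (cl_sym P ix) _; exact: (H (n.+1, i)).
Qed.

Definition near_pair n (p p' : J * J) := cl n p.1 p'.1 /\ cl n p.2 p'.2.

Definition pair_closed (F : set (J * J)) := forall p,
  (forall n, exists2 p', F p' & near_pair n p p') -> F p.

(** These are the analytic sets: the Souslin operation applied to closed sets indexed by finite
    sequences. *)
Definition souslin (A : set (J * J)) := exists2 F : seq nat -> set (J * J),
  forall s, pair_closed (F s) &
  forall p, A p <-> exists sigma, forall k, F (mkseq sigma k) p.

Lemma closed_souslin A : pair_closed A -> souslin A.
Proof.
move=> cA; exists (fun=> A) => // p; split => [Ap|[s /(_ 0)//]].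
by exists id.
Qed.

Lemma souslin_choice (A : (set (J * J))^nat) : (forall n, souslin (A n)) ->
  exists2 F : nat -> seq nat -> set (J * J), forall n s, pair_closed (F n s) &
    forall n p, A n p <-> exists sigma, forall k, F n (mkseq sigma k) p.
Proof.
move=> sA; have /choice[F FA] : forall n, exists F : seq nat -> set (J * J),
    (forall s, pair_closed (F s)) /\
    forall p, A n p <-> exists sigma, forall k, F (mkseq sigma k) p.
  by move=> n; have [F cF FA] := sA n; exists F.
by exists F => n; have [] := FA n.
Qed.

(** The first letter of a branch selects the set [A n], and the remaining letters follow its
    scheme. *)
Lemma souslin_bigcup (A : (set (J * J))^nat) :
  (forall n, souslin (A n)) -> souslin (\bigcup_n A n).
Proof.
move=> /souslin_choice[F cF FA].
exists (fun s => if s is n :: s' then F n s' else setT).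
  by case=> // n s; exact: cF.
have mkS (s : nat -> nat) k : mkseq s k.+1 = s 0 :: mkseq (s \o succn) k.
  by rewrite /mkseq /= -[1]addn0 iotaDl -map_comp.
move=> p; split => [[n _ /FA[s Fs]]|[s Fs]].
  exists (fun k => if k is k'.+1 then s k' else n) => -[//|k].
  by rewrite mkS; exact: Fs.
exists (s 0) => //; apply/FA; exists (s \o succn) => k.
by move: (Fs k.+1); rewrite mkS.
Qed.

(** One branch encodes a branch for every [n], the [j]-th letter of the [n]-th one being stored at
    position [pr n j]. A prefix imposes all the conditions whose letters it contains. *)
Lemma souslin_bigcap (A : (set (J * J))^nat) :
  (forall n, souslin (A n)) -> souslin (\bigcap_n A n).
Proof.
move=> /souslin_choice[F cF FA].
pose pr (n j : nat) := choice.pickle ((n, j) : nat * nat).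
exists (fun s => [set p | forall n k, (forall j, j < k -> pr n j < size s) ->
  F n (mkseq (fun j => nth 0 s (pr n j)) k) p]).
  move=> s p H n k jk; apply: cF => m.
  by have [p' Fp' pp'] := H m; exists p' => //; exact: Fp'.
move=> p; split => [Ap|[s Fs] n _].
  have {}Ap n : exists s, forall k, F n (mkseq s k) p by exact/FA/Ap.
  have {Ap}[s Fs] := choice Ap.
  exists (fun m => if choice.unpickle m is Some nj then s nj.1 nj.2 else 0) => m n k jk.
  rewrite (_ : mkseq _ _ = mkseq (s n) k)//; apply/eq_in_map => j.
  rewrite mem_iota /= add0n => /jk; rewrite size_mkseq => jm.
  by rewrite nth_mkseq// /pr choice.pickleK.
apply/FA; exists (fun j => s (pr n j)) => k.
pose m := (\max_(j < k) pr n j).+1.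
have jm j : j < k -> pr n j < m.
  by move=> jk; rewrite ltnS; exact: (@leq_bigmax _ (fun j : 'I_k => pr n j) (Ordinal jk)).
have := Fs m n k; rewrite size_mkseq => /(_ jm).
rewrite (_ : mkseq _ _ = mkseq (fun j => s (pr n j)) k)//; apply/eq_in_map => j.
by rewrite mem_iota /= add0n => /jm jm'; rewrite nth_mkseq.
Qed.

(** Including the complement makes the property stable under complementation, so that induction over
    the sigma-algebra applies. *)
Definition bisouslin A := souslin A /\ souslin (~` A).

Lemma bisouslin_bigcup (A : (set (J * J))^nat) :
  (forall n, bisouslin (A n)) -> bisouslin (\bigcup_n A n).
Proof.
move=> sA; split; first by apply: souslin_bigcup => n; have [] := sA n.
by rewrite setC_bigcup; apply: souslin_bigcap => n; have [] := sA n.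
Qed.

Lemma bisouslinC A : bisouslin A -> bisouslin (~` A).
Proof. by case=> ? ?; split => //; rewrite setCK. Qed.

Lemma bisouslin0 : bisouslin set0.
Proof.
split; last by rewrite setC0; exact: closed_souslin.
by apply: closed_souslin => p /(_ 0)[].
Qed.

(** A closed ball pulled back by a nonexpansive map is closed, and its complement is the union of
    the pulled-back balls about points of [q] that are disjoint from it. *)
Lemma bisouslin_ball (f : J * J -> J) k i :
  (forall n p p', near_pair n p p' -> cl n (f p) (f p')) ->
  bisouslin (f @^-1` [set y | cl k (q i) y]).
Proof.
move=> fcl.
have cball m j : pair_closed (f @^-1` [set y | cl m (q j) y]).
  move=> p H; apply: (cl_closed P) => n; have [p' Fp' /fcl pp'] := H n.
  by exists (f p') => //; exact: (cl_sym P).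
split; first exact: closed_souslin.
have -> : ~` (f @^-1` [set y | cl k (q i) y]) = \bigcup_m \bigcup_j
    if `[< forall y, cl m (q j) y -> ~ cl k (q i) y >]
    then f @^-1` [set y | cl m (q j) y] else set0.
  apply/seteqP; split => p /= => [np|[m _ [j _]]]; last first.
    by case: asboolP => // mj /= /mj.
  apply: contrapT => H; apply: np; apply: (cl_closed P) => n.
  have [j jp] := cl_dense P n.+1 (f p).
  apply: contrapT => H'; apply: H; exists n.+1 => //; exists j => //.
  case: asboolP => // -[]; move=> y jy iy; apply: H'; exists y => //.
  by apply: (cl_tri P) (cl_sym P jy) jp.
apply: souslin_bigcup => m; apply: souslin_bigcup => j.
by case: asboolP => _; [exact: closed_souslin|exact: bisouslin0.1].
Qed.

Lemma measurable_souslin A : measurable A -> souslin A.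
Proof.
suff : measurable A -> bisouslin A by move=> H /H[].
have bC (f : J * J -> J) B :
    (forall n p p', near_pair n p p' -> cl n (f p) (f p')) ->
    measurable B -> bisouslin (f @^-1` B).
  move=> fcl /(cl_generate P).
  apply: (@sigma_algebra_ind _ _ (fun B => bisouslin (f @^-1` B))).
  - by move=> _ [n [i ->]]; exact: bisouslin_ball.
  - by rewrite preimage_set0; exact: bisouslin0.
  - by move=> {}B; rewrite preimage_setC; exact: bisouslinC.
  - by move=> F sF; rewrite preimage_bigcup; exact: bisouslin_bigcup.
rewrite measurable_prod_measurableType.
apply: sigma_algebra_ind; [|exact: bisouslin0|exact: bisouslinC|
  exact: bisouslin_bigcup].
move=> _ [B mB [C mC <-]].
rewrite (_ : B `*` C = ~` (~` (fst @^-1` B) `|` ~` (snd @^-1` C))); last first.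
  by rewrite setCU !setCK.
rewrite -bigcup2E; apply/bisouslinC/bisouslin_bigcup => -[|[|n]] /=.
- by apply/bisouslinC/bC => // n p p' [].
- by apply/bisouslinC/bC => // n p p' [].
- exact: bisouslin0.
Qed.

(** Joint separation in the sense of Novikov: the Borel supersets have no point common to all of
    them, although some of them may meet. *)
Definition sep (I : Type) (A : I -> set J) := exists B : I -> set J,
  [/\ forall i, measurable (B i), forall i, A i `<=` B i &
      forall x, ~ forall i, B i x].

(** A point enters the new [i]-th set through a letter [m] if it lies in the [i]-th separator of
    every choice [c] with [c i = m]. A common point would enter through letters forming a single
    choice, whose separators have no common point. As [I] is finite, there are countably many
    choices. *)
Lemma sep_split (I : finType) (K : countType) (A : I -> set J)
    (C : I -> K -> set J) : (forall i, A i `<=` \bigcup_k C i k) ->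
  (forall c : {ffun I -> K}, sep (fun i => C i (c i))) -> sep A.
Proof.
move=> AC /choice[B sB].
exists (fun i => [set x | exists m, forall c : {ffun I -> K}, c i = m -> B c i x]).
split => [i|i x /AC[m _ Cx]|x].
- apply: measurable_exists => m; apply: measurable_forall => c.
  by apply: measurable_impl; [exact: measurable_cstP|have [mB _ _] := sB c; exact: mB].
- by exists m => c cm; have [_ CB _] := sB c; apply: CB; rewrite cm.
- move=> /choice[m mB]; pose c := [ffun i => m i] : {ffun I -> K}.
  have [_ _ /(_ x)] := sB c; apply => i; apply: mB; exact: ffunE.
Qed.

End polish_theory.

(** * The Lusin-Novikov theorem for bounded sections *)

Section novikov.
Context (d : measure_display) (J : measurableType d).
Context (cl : nat -> J -> J -> Prop) (q : nat -> J) (P : polish cl q).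

(* If the projections were not separated, splitting each [E i] countably many
   ways according to the next letter of a Souslin scheme and to small balls would
   leave some choice of pieces unseparated, forever; by completeness these pieces
   shrink to points with a common first coordinate. *)
Lemma novikov_separation n (E : 'I_n.+1 -> set (J * J)) :
  (forall i, souslin cl (E i)) -> (forall x, ~ forall i, exists y, E i (x, y)) ->
  sep (fun i => [set x | exists y, E i (x, y)]).
Proof.
move=> sE disj.
have /choice[F FP] : forall i, exists F : seq nat -> set (J * J),
    (forall s, pair_closed cl (F s)) /\
    forall p, E i p <-> exists sigma, forall k, F (mkseq sigma k) p.
  by move=> i; have [F cF FE] := sE i; exists F.
(* A letter prescribes the next entry of a Souslin branch and the centres of two balls, one for each
   coordinate of the point. *)
pose K : countType := (nat * (nat * nat))%type.
pose k0 : K := (0, (0, 0)).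
pose part i (s : seq K) := [set x | exists y (tau : nat -> nat),
  [/\ forall j, j < size s -> tau j = (nth k0 s j).1,
      forall m, F i (mkseq tau m) (x, y) &
      forall j, j < size s -> cl j (q (nth k0 s j).2.1) x /\
                              cl j (q (nth k0 s j).2.2) y]].
apply: contrapT => nsep.
have /choice[c cP] : forall s : 'I_n.+1 -> seq K, exists c : {ffun 'I_n.+1 -> K},
    ~ sep (fun i => part i (s i)) -> ~ sep (fun i => part i (rcons (s i) (c i))).
  move=> s; have [|ns] := pselect (sep (fun i => part i (s i))).
    by exists [ffun=> k0].
  apply: contrapT => H; apply: ns.
  apply: (@sep_split _ _ _ K _ (fun i k => part i (rcons (s i) k))); last first.
    by move=> c; apply: contrapT => nc; apply: H; exists c.
  move=> i x [y [tau [taus Ftau near]]].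
  have [a xa] := cl_dense P (size (s i)) x.
  have [b yb] := cl_dense P (size (s i)) y.
  exists (tau (size (s i)), (a, b)) => //; exists y, tau; split => // j.
    rewrite size_rcons ltnS leq_eqVlt => /predU1P[->|js].
      by rewrite nth_rcons ltnn eqxx.
    by rewrite nth_rcons js; exact: taus.
  rewrite size_rcons ltnS leq_eqVlt => /predU1P[->|js].
    by rewrite nth_rcons ltnn eqxx.
  by rewrite nth_rcons js; exact: near.
pose S m := iter m (fun s i => rcons (s i) (c s i)) (fun=> [::]).
pose l (i : 'I_n.+1) m : K := c (S m) i.
have SE m i : S m i = mkseq (l i) m.
  by elim: m => // m IH; rewrite mkseqS -IH.
have {}nsep m : ~ sep (fun i => part i (mkseq (l i) m)).
  under eq_fun do rewrite -SE.
  elim: m => [[B [mB AB B0]]|m IH]; last exact: cP.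
  apply: nsep; exists B; split => // i x [y Ey]; apply: AB.
  have [tau Ftau] := ((FP i).2 (x, y)).1 Ey.
  by exists y, tau.
(* An empty part would be separated by [set0] against the whole space. In [close], likewise, balls
   of radius [2^-m] without a common point would themselves separate the parts. *)
have nonempty i m : exists x, part i (mkseq (l i) m) x.
  apply: contrapT => H; apply: (nsep m).
  exists (fun j => if j == i then set0 else setT); split => [j|j x jx|x /(_ i)].
  - by case: ifP.
  - by case: ifP => // /eqP ji; rewrite ji in jx; apply: H; exists x.
  - by rewrite eqxx.
have close m : exists z, forall i, cl m (q (l i m).2.1) z.
  apply: contrapT => H; apply: (nsep m.+1).
  exists (fun i => [set z | cl m (q (l i m).2.1) z]); split.
  - by move=> i; exact: (cl_measurable P).
  - move=> i x [y [tau [_ _ /(_ m)]]]; rewrite size_mkseq ltnSn => /(_ isT)[].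
    by rewrite nth_mkseq.
  - by move=> x xH; apply: H; exists x.
have /choice[x xP] : forall i, exists x, forall k, cl k (q (l i k).2.1) x.
  move=> i; apply: (cl_nested P) => m.
  have [x [y [tau [_ _ xy]]]] := nonempty i m; exists x => k km.
  by have := xy k; rewrite size_mkseq => /(_ km)[]; rewrite nth_mkseq.
have /choice[y yP] : forall i, exists y, forall k, cl k (q (l i k).2.2) y.
  move=> i; apply: (cl_nested P) => m.
  have [x' [y [tau [_ _ xy]]]] := nonempty i m; exists y => k km.
  by have := xy k; rewrite size_mkseq => /(_ km)[_]; rewrite nth_mkseq.
have xx i j : x i = x j.
  apply: (cl_sep P) => m; have [z cz] := close m.+2.
  apply: (@cl_tri _ _ _ _ P _ z).
    exact: (cl_tri P) (cl_sym P (xP i m.+2)) (cz i).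
  exact: (cl_tri P) (cl_sym P (cz j)) (xP j m.+2).
apply: (disj (x ord0)) => i; exists (y i); rewrite (xx ord0 i).
apply/(FP i).2; exists (fun k => (l i k).1) => k.
(* A part of depth [r] fixes the first [k] entries of the branch and also the balls of index [m.+1],
   which puts its points within [2^-m] of the limit. *)
apply: (FP i).1 => m; pose r := maxn k m.+2.
have [x' [y' [tau [taul Ftau xy']]]] := nonempty i r.
exists (x', y').
  rewrite (_ : mkseq _ _ = mkseq tau k)//; apply/eq_in_map => j.
  rewrite mem_iota /= add0n => jk; have jr : j < r by rewrite leq_max jk.
  by rewrite taul ?size_mkseq// nth_mkseq.
have mr : m.+1 < r by rewrite leq_max leqnn orbT.
have := xy' m.+1; rewrite size_mkseq nth_mkseq// => /(_ mr)[xm ym].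
split => /=; first exact: (cl_tri P) (cl_sym P (xP i m.+1)) xm.
exact: (cl_tri P) (cl_sym P (yP i m.+1)) ym.
Qed.

Lemma measurable_fun_cl d' (T : measurableType d') (f : T -> J) :
  (forall n i, measurable [set x | cl n (q i) (f x)]) -> measurable_fun setT f.
Proof.
move=> mf _ A mA; rewrite setTI; move: A {mA}(cl_generate P mA).
apply: (@sigma_algebra_ind _ _ (fun A => measurable (f @^-1` A))).
- by move=> _ [n [i ->]]; exact: mf.
- by rewrite preimage_set0.
- by move=> A mA; rewrite preimage_setC; exact: measurableC.
- by move=> F mF; rewrite preimage_bigcup; exact: bigcupT_measurable.
Qed.

End novikov.

Lemma take_mkseq T (f : nat -> T) m n : m <= n -> take m (mkseq f n) = mkseq f m.
Proof. by move=> mn; rewrite -map_take take_iota (minn_idPl mn). Qed.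

Section lusin_novikov.
Context (d : measure_display) (J : measurableType d).
Context (cl : nat -> J -> J -> Prop) (q : nat -> J) (P : polish cl q).

(** Taking the least index of a suitable centre makes each letter of the address Borel; the whole
    address determines the point. *)
Let address : exists addr : J -> nat -> nat,
  (forall y k, cl k (q (addr y k)) y) /\
  forall k i, measurable [set y | addr y k = i].
Proof.
have ex y k : exists i, `[< cl k (q i) y >].
  by have [i iy] := cl_dense P k y; exists i; exact/asboolP.
exists (fun y k => ex_minn (ex y k)); split => [y k|k i].
  by case: ex_minnP => m /asboolP.
rewrite (_ : [set y | _] =
    [set y | cl k (q i) y /\ forall j, j < i -> ~ cl k (q j) y]).
  apply: measurable_conj; first exact: (cl_measurable P).
  apply: measurable_forall => j; apply: measurable_impl.
    exact: measurable_cstP.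
  by apply: measurable_neg; exact: (cl_measurable P).
apply/seteqP; split => y /=; case: ex_minnP => m /asboolP my mmin.
  by move=> <-; split => // j jm /asboolP/mmin; rewrite leqNgt jm.
move=> [iy imin]; apply/eqP; rewrite eqn_leq mmin ?andTb; last exact/asboolP.
by rewrite leqNgt; apply/negP => /imin.
Qed.

Variables (E : set (J * J)) (D : nat).
Hypothesis mE : measurable E.
Hypothesis hD : forall x (t : 'I_D.+1 -> J), injective t -> ~ forall i, E (x, t i).

Let valid (t : {ffun 'I_D.+1 -> seq nat}) :=
  injective t /\ forall i j, size (t i) = size (t j).

(** Neighbours with distinct address prefixes of equal length are distinct, so no [x] has neighbours
    with [D+1] such prefixes, and Novikov separation applies. Intersecting the separators over all
    families containing [s] yields a single set [C s]; at most [D] prefixes of each length are then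
    allowed at [x]. *)
Let separators (addr : J -> nat -> nat) :
  (forall k i, measurable [set y | addr y k = i]) ->
  exists C : seq nat -> set J, [/\ forall s, measurable (C s),
    forall x y m, E (x, y) -> C (mkseq (addr y) m) x &
    forall x t, valid t -> ~ forall i, C (t i) x].
Proof.
move=> maddr; pose U (s : seq nat) := [set y | mkseq (addr y) (size s) = s].
have mU s : measurable (U s).
  rewrite (_ : U s = [set y | forall j, j < size s -> addr y j = nth 0 s j]).
    apply: measurable_forall => j; apply: measurable_impl => //.
    exact: measurable_cstP.
  apply/seteqP; split => y /=; rewrite /U /=.
    by move=> <- j; rewrite size_mkseq => js; rewrite nth_mkseq.
  move=> H; apply: (@eq_from_nth _ 0); rewrite size_mkseq// => j js.
  by rewrite nth_mkseq// H.
have /choice[B BP] : forall t, exists B : 'I_D.+1 -> set J,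
    (forall i, measurable (B i)) /\ (valid t ->
      (forall i x y, E (x, y) -> U (t i) y -> B i x) /\
      forall x, ~ forall i, B i x).
  move=> t; have [[tinj tsz]|nvt] := pselect (valid t); last first.
    by exists (fun=> set0); split.
  have [|x|B [mB BU B0]] :=
      @novikov_separation _ _ _ _ P D (fun i => [set p | E p /\ U (t i) p.2]).
  - move=> i; apply: (measurable_souslin P); apply: measurable_conj => //.
    exact: (measurable_preimage (@measurable_snd _ _ J J)).
  - move=> /choice[y Ey]; apply: (@hD x y); last by move=> i; have [] := Ey i.
    move=> i j yij; apply: tinj; have [_ /= <-] := Ey i; have [_ /= <-] := Ey j.
    by rewrite yij (tsz i j).
  exists B; split => // _; split => // i x y Exy Uy; apply: BU; exists y.
  by split.
exists (fun s => [set x | forall t, valid t -> forall i, t i = s -> B t i x]).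
split.
- move=> s; apply: measurable_forall => t; apply: measurable_impl.
    exact: measurable_cstP.
  apply: measurable_forall => i; apply: measurable_impl; last exact: (BP t).1.
  exact: measurable_cstP.
- move=> x y m Exy t vt i tim; have [+ _] := (BP t).2 vt.
  by move=> /(_ i x y Exy); apply; rewrite tim /U /= size_mkseq.
- move=> x t vt H; have [_] := (BP t).2 vt; move=> /(_ x); apply => i.
  exact: (H i t vt i).
Qed.

(* A live node is a prefix all of whose initial segments are allowed at [x];
   each level has at most [D] of them, so every branch is eventually the only
   one through its own initial segments. *)
Theorem lusin_novikov_bounded : exists2 g : nat -> J -> J,
  forall n, measurable_fun setT (g n) &
  forall x y, E (x, y) -> exists n, y = g n x.
Proof.
have [addr [addrP maddr]] := address.
have [C [mC EC CD]] := separators maddr.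
(* [T'] selects the words that extend to allowed words of every length. If [s] has a unique such
   continuation at some level, its letters do not depend on the level, and [Lim] is the point with
   this address. *)
pose T s x := forall j, j <= size s -> C (take j s) x.
pose T' s x := forall m, exists u, size u = m /\ T (s ++ u) x.
pose good (s : seq nat) n t x := [/\ size t = n, take (size s) t = s, T' t x &
  forall t', size t' = n -> take (size s) t' = s -> T' t' x -> t' = t].
pose letter s k i x := exists n t,
  [/\ k < n, size s <= n, good s n t x & nth 0 t k = i].
pose Lim s x z := forall k, exists i, letter s k i x /\ cl k (q i) z.
have mT s : measurable [set x | T s x].
  apply: measurable_forall => j; apply: measurable_impl.
    exact: measurable_cstP.
  exact: mC.
have mT' s : measurable [set x | T' s x].
  apply: measurable_forall => m; apply: measurable_exists => u.
  by apply: measurable_conj => //; exact: measurable_cstP.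
have mgood s n t : measurable [set x | good s n t x].
  rewrite /good (_ : [set x | _] = [set x | (size t = n /\ take (size s) t = s) /\
    (T' t x /\ forall t', size t' = n -> take (size s) t' = s -> T' t' x ->
      t' = t)]); last first.
    by apply/seteqP; split => x; [case|move=> [[? ?] []]].
  apply: measurable_conj; first exact: measurable_cstP.
  apply: measurable_conj => //; apply: measurable_forall => t'.
  do 2 (apply: measurable_impl; first exact: measurable_cstP).
  by apply: measurable_impl => //; exact: measurable_cstP.
have mletter s k i : measurable [set x | letter s k i x].
  apply: measurable_exists => n; apply: measurable_exists => t.
  rewrite (_ : [set x | _] = [set x | (k < n /\ size s <= n /\ nth 0 t k = i)
      /\ good s n t x]); last first.
    by apply/seteqP; split => x; [case|move=> [[? [? ?]] ?]; split].
  by apply: measurable_conj => //; exact: measurable_cstP.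
have T_take s x j : T s x -> T (take j s) x.
  move=> Ts i; rewrite size_take_min leq_min => /andP[ij ijs].
  by rewrite take_takel//; exact: Ts.
have T'_take t x n : n <= size t -> T' t x -> T' (take n t) x.
  move=> nt T't m; have [u [um Tu]] := T't m.
  exists (take m (drop n (t ++ u))); split.
    by rewrite size_takel// size_drop size_cat um; lia.
  suff -> : take n t ++ take m (drop n (t ++ u)) = take (n + m) (t ++ u).
    exact: T_take.
  by rewrite takeD take_cat; case: ltngtP nt => // -> _; rewrite take_size subnn take0 cats0.
have letter_uniq s k i i' x : letter s k i x -> letter s k i' x -> i = i'.
  move=> [n [t [kn sn gt <-]]] [n' [t' [kn' sn' gt' <-]]].
  wlog nn' : n n' t t' kn sn gt kn' sn' gt' / n <= n'.
    by move=> W; have [/W|/ltnW/W] := leqP n n'; [|move=> W'; apply/esym]; auto.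
  have [tn ts T't tuniq] := gt; have [t'n t's T't' _] := gt'.
  (* The longer word cut to the shorter length is still extendable, hence equal to the unique word
     there. *)
  rewrite -(tuniq (take n t')) ?nth_take//.
  - by rewrite size_takel// t'n.
  - by rewrite take_takel.
  - by apply: T'_take => //; rewrite t'n.
have ET x y m : E (x, y) -> T (mkseq (addr y) m) x.
  by move=> Exy j; rewrite size_mkseq => jm; rewrite take_mkseq//; exact: EC.
have ET' x y m : E (x, y) -> T' (mkseq (addr y) m) x.
  move=> Exy k; exists (drop m (mkseq (addr y) (m + k))).
  rewrite size_drop size_mkseq addKn; split => //.
  by rewrite -(@take_mkseq _ _ _ (m + k)) ?leq_addr// cat_take_drop; exact: ET.
(* If the branch of [y] were never the only one, other words would leave it above every level, and
   [D+1] of them could be extended to a common length, against [CD]. *)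
have branch x y : E (x, y) ->
    exists N, forall n, N <= n -> good (mkseq (addr y) N) n (mkseq (addr y) n) x.
  move=> Exy; apply: contrapT => H; set pre := mkseq (addr y) in H.
  have {}H N : exists n t, [/\ N <= n, size t = n, take N t = pre N, T' t x &
      t <> pre n].
    apply: contrapT => HN; apply: H; exists N => n Nn; split.
    - by rewrite size_mkseq.
    - by rewrite size_mkseq take_mkseq.
    - exact: ET'.
    - move=> t tn; rewrite size_mkseq => tN T't; apply: contrapT => tpre.
      by apply: HN; exists n, t.
  (* The new word has left the branch by level [n], while those supplied by induction still follow
     it up to [n]; hence it differs from them all after extension to length [M]. *)
  have claim r N : exists M (ts : seq (seq nat)), [/\ N <= M, uniq ts, size ts = r &
      forall t, t \in ts -> [/\ size t = M, T t x, take N t = pre N &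
        t <> pre M]].
    elim: r N => [|r IH] N; first by exists N, [::].
    have [n [t [Nn tn tN T't tpre]]] := H N.
    have [M [ts [nM uts sts tsP]]] := IH n.
    have [u [uM Tu]] := T't (M - n).
    have tun : take n (t ++ u) = t by rewrite take_cat tn ltnn subnn take0 cats0.
    exists M, ((t ++ u) :: ts); split.
    - exact: leq_trans nM.
    - rewrite /= uts andbT; apply/negP => /tsP[_ _ +  _].
      by rewrite tun.
    - by rewrite /= sts.
    - move=> v; rewrite inE => /predU1P[->|/tsP[vM Tv vn vpre]]; split => //.
      + by rewrite size_cat uM tn subnKC.
      + by rewrite -[LHS](@take_takel _ N n)// tun.
      + by move=> /(congr1 (take n)); rewrite tun take_mkseq.
      + by rewrite -[LHS](@take_takel _ N n)// vn /pre take_mkseq.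
  have [M [ts [_ uts sts tsP]]] := claim D.+1 0.
  have {}tsP (i : 'I_D.+1) : size (nth [::] ts i) = M /\ T (nth [::] ts i) x.
    by have [|] := tsP (nth [::] ts i); rewrite ?mem_nth// sts.
  pose t := [ffun i : 'I_D.+1 => nth [::] ts i].
  apply: (CD x t); first split.
  - move=> i j; rewrite !ffunE => /eqP; rewrite nth_uniq ?sts ?ltn_ord//.
    by move=> /eqP/val_inj.
  - by move=> i j; rewrite !ffunE (tsP i).1 (tsP j).1.
  - move=> i; rewrite ffunE; have [_ Tt] := tsP i.
    by have := Tt _ (leqnn _); rewrite take_size.
have EL x y : E (x, y) -> exists s, Lim s x y.
  move=> Exy; have [N NP] := branch _ _ Exy; exists (mkseq (addr y) N) => k.
  exists (addr y k); split => //; pose n := maxn k.+1 N.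
  exists n, (mkseq (addr y) n); split.
  - by rewrite leq_maxl.
  - by rewrite size_mkseq leq_maxr.
  - by apply: NP; rewrite leq_maxr.
  - by rewrite nth_mkseq// leq_maxl.
have Lim_uniq s x z z' : Lim s x z -> Lim s x z' -> z = z'.
  move=> Lz Lz'; apply: (cl_sep P) => n.
  have [i [li iz]] := Lz n.+1; have [i' [li' iz']] := Lz' n.+1.
  by rewrite (letter_uniq _ _ _ _ _ li' li) in iz';
    exact: (cl_tri P) (cl_sym P iz) iz'.
pose V s x := exists z, Lim s x z.
(* By [cl_nested] a limit exists as soon as finitely many of the balls always meet. For a fixed word
   [t] this no longer involves [x], so only countable quantifiers remain. *)
have mV s : measurable [set x | V s x].
  rewrite (_ : [set x | _] = [set x | forall m, exists t : seq nat,
      (forall k, k < m -> letter s k (nth 0 t k) x) /\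
      exists z, forall k, k < m -> cl k (q (nth 0 t k)) z]).
    apply: measurable_forall => m; apply: measurable_exists => t.
    apply: measurable_conj; last exact: measurable_cstP.
    apply: measurable_forall => k; apply: measurable_impl => //.
    exact: measurable_cstP.
  apply/seteqP; split => x /= => [[z /choice[i iz]] m|H].
    exists (mkseq i m); split.
      by move=> k km; rewrite nth_mkseq//; have [] := iz k.
    by exists z => k km; rewrite nth_mkseq//; have [] := iz k.
  have /choice[i iP] : forall k, exists i, letter s k i x.
    by move=> k; have [t [tk _]] := H k.+1; exists (nth 0 t k); exact: tk.
  have [m|z iz] := @cl_nested _ _ _ _ P (q \o i); last first.
    by exists z => k; exists (i k).
  have [t [tk [z tz]]] := H m; exists z => k km /=.
  by rewrite (letter_uniq _ _ _ _ _ (iP k) (tk _ km)); exact: tz.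
pose g s x := xget (q 0) [set z | Lim s x z].
have gE s x z : Lim s x z -> g s x = z.
  by move=> Lz; rewrite /g; case: xgetP => [y _ L|/(_ z)//]; exact: Lim_uniq L Lz.
exists (fun n => if choice.unpickle n is Some s then g s else cst (q 0)); last first.
  move=> x y /EL[s /gE gs]; exists (choice.pickle s).
  by rewrite choice.pickleK gs.
move=> m; case: choice.unpickle => [s|]; last exact: measurable_cst.
apply: (measurable_fun_cl P) => n j.
(* The limit lies in the closed ball about [q j] exactly when each of its address balls meets that
   ball; outside [V s] the default [q 0] decides. *)
rewrite (_ : [set x | _] = [set x | (V s x /\ forall k, exists i,
      letter s k i x /\ exists w, cl k (q i) w /\ cl n (q j) w) \/
    (~ V s x /\ cl n (q j) (q 0))]).
  apply: measurable_disj; apply: measurable_conj => //; last exact: measurable_cstP.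
    apply: measurable_forall => k; apply: measurable_exists => i.
    by apply: measurable_conj => //; exact: measurable_cstP.
  exact: measurable_neg.
apply/seteqP; split => x /=.
  have [[z Lz]|nV] := pselect (V s x).
    rewrite (gE _ _ _ Lz) => jz; left; split; first by exists z.
    by move=> k; have [i [li iz]] := Lz k; exists i; split => //; exists z.
  by rewrite /g; case: xgetP => [z _ Lz|]; [case: nV; exists z|right].
case=> [[[z Lz] H]|[nV]].
  rewrite (gE _ _ _ Lz); apply: (cl_closed P) => k.
  have [i [li [w [iw jw]]]] := H k.+1; exists w => //.
  have [i' [li' i'z]] := Lz k.+1; rewrite (letter_uniq _ _ _ _ _ li' li) in i'z.
  exact: (cl_tri P) (cl_sym P iw) i'z.
by rewrite /g; case: xgetP => [z _ Lz|//]; case: nV; exists z.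
Qed.

End lusin_novikov.

(** * Partial isomorphisms and mass transport *)

Local Open Scope ring_scope.

(** * Counting by sums, and integrals over restricted measures *)

Section counting_esum.
Local Open Scope ereal_scope.
Context (R : realType) (T : choiceType).

Lemma esum_cst1 (A : set T) : \esum_(x in A) (1 : \bar R) = counting A.
Proof.
rewrite /counting; case: asboolP => [fA|/infinite_set_fset iA].
  by rewrite esum_fset// fsbig_finite// sumEFin big_const_seq iter_addr_0 count_predT.
apply: eq_infty => r.
have [B BA rB] := iA (Num.truncn r).+1.
apply: esum_ge; exists [set` B]; first by split.
rewrite fsbig_finite// set_fsetK sumEFin big_const_seq iter_addr_0 count_predT.
rewrite lee_fin; apply: le_trans (ltW (truncnS_gt r)) _.
by rewrite ler_nat.
Qed.


End counting_esum.

Section integral_mrestr.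
Local Open Scope ereal_scope.
Context (d : measure_display) (T : measurableType d) (R : realType).
Variable mu : {measure set T -> \bar R}.

Lemma ge0_integral_mrestr (D : set T) (mD : measurable D) (f : T -> \bar R) :
  measurable_fun setT f -> (forall x, 0 <= f x) ->
  \int[mrestr mu mD]_x f x = \int[mu]_(x in D) f x.
Proof.
move=> mf f0; rewrite -(setUv D) ge0_integral_setU//; last 3 first.
- exact: measurableC.
- by rewrite setUv.
- exact/disj_set2P/subsets_disjoint.
rewrite (@eq_measure_integral _ _ _ D mu); last first.
  by move=> A mA AD; rewrite /= /mrestr setIidl.
rewrite (@eq_measure_integral _ _ _ (~` D) mzero) ?integral_measure_zero ?adde0//.
move=> A mA AD; rewrite /= /mrestr; have -> : A `&` D = set0.
  by apply/seteqP; split => x // [/AD].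
by rewrite measure0.
Qed.

End integral_mrestr.

(** A measure-preserving Borel bijection from [dom] onto [cod]. Both directions are total maps, with
    arbitrary values outside these sets, so that composition stays simple. *)
Record piso (d : measure_display) (J : measurableType d) (R : realType)
    (lambda : set J -> \bar R) := Piso {
  fw : J -> J ; bw : J -> J ; dom : set J ; cod : set J ;
  piso_fw : measurable_fun setT fw ;
  piso_bw : measurable_fun setT bw ;
  piso_dom : measurable dom ;
  piso_cod : measurable cod ;
  piso_fwP : forall x, dom x -> cod (fw x) /\ bw (fw x) = x ;
  piso_bwP : forall y, cod y -> dom (bw y) /\ fw (bw y) = y ;
  piso_inv : forall A, measurable A ->
    lambda [set x | dom x /\ A (fw x)] = lambda [set y | cod y /\ A y] }.

Section piso_theory.
Context (d : measure_display) (J : measurableType d) (R : realType).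
Variable lambda : {measure set J -> \bar R}.
Local Notation piso := (piso lambda).

Definition piso_id : piso.
Proof.
by exists id id setT setT => //; exact: measurable_id.
Defined.

Definition piso_comp (P Q : piso) : piso.
Proof.
exists (fw Q \o fw P) (bw P \o bw Q) [set x | dom P x /\ dom Q (fw P x)]
  [set y | cod Q y /\ cod P (bw Q y)].
- by apply: measurableT_comp; [exact: piso_fw|exact: piso_fw].
- by apply: measurableT_comp; [exact: piso_bw|exact: piso_bw].
- apply: measurable_conj; first exact: piso_dom.
  exact: (measurable_preimage (@piso_fw _ _ _ _ P) (@piso_dom _ _ _ _ Q)).
- apply: measurable_conj; first exact: piso_cod.
  exact: (measurable_preimage (@piso_bw _ _ _ _ Q) (@piso_cod _ _ _ _ P)).
- move=> x /= [Px Qx]; have [cP bP] := piso_fwP Px.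
  by have [cQ bQ] := piso_fwP Qx; rewrite bQ.
- move=> y /= [Qy Py]; have [cP bP] := piso_bwP Py.
  by have [cQ bQ] := piso_bwP Qy; rewrite bP.
- move=> A mA /=.
  have mQA : measurable [set y | dom Q y /\ A (fw Q y)].
    apply: measurable_conj; first exact: piso_dom.
    exact: (measurable_preimage (@piso_fw _ _ _ _ Q)).
  have mPA : measurable [set z | cod P (bw Q z) /\ A z].
    apply: measurable_conj => //.
    exact: (measurable_preimage (@piso_bw _ _ _ _ Q) (@piso_cod _ _ _ _ P)).
  transitivity (lambda [set x | dom P x /\ [set y | dom Q y /\ A (fw Q y)] (fw P x)]).
    by congr (lambda _); apply/seteqP; split => x /=; tauto.
  rewrite piso_inv//.
  transitivity (lambda [set y | dom Q y /\ [set z | cod P (bw Q z) /\ A z] (fw Q y)]).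
    congr (lambda _); apply/seteqP; split => y /=.
      by move=> [Py [Qy Ay]]; have [_ ->] := piso_fwP Qy.
    by move=> [Qy []]; have [_ ->] := piso_fwP Qy.
  by rewrite piso_inv//; congr (lambda _); apply/seteqP; split => x /=; tauto.
Defined.

Definition piso_restr (P : piso) (B : set J) (mB : measurable B) : piso.
Proof.
exists (fw P) (bw P) [set x | dom P x /\ B x] [set y | cod P y /\ B (bw P y)].
- exact: piso_fw.
- exact: piso_bw.
- by apply: measurable_conj => //; exact: piso_dom.
- apply: measurable_conj; first exact: piso_cod.
  exact: (measurable_preimage (@piso_bw _ _ _ _ P)).
- by move=> x /= [Px Bx]; have [cP bP] := piso_fwP Px; rewrite bP.
- by move=> y /= [Py By]; have [dP fP] := piso_bwP Py.
- move=> A mA.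
  have mAB : measurable [set y | A y /\ B (bw P y)].
    apply: measurable_conj => //.
    exact: (measurable_preimage (@piso_bw _ _ _ _ P)).
  transitivity (lambda [set x | dom P x /\ [set y | A y /\ B (bw P y)] (fw P x)]).
    congr (lambda _); apply/seteqP; split => x /=.
      by move=> [[Px Bx] Ax]; have [_ ->] := piso_fwP Px.
    by move=> [Px []]; have [_ ->] := piso_fwP Px.
  by rewrite piso_inv//; congr (lambda _); apply/seteqP; split => x /=; tauto.
Defined.

Lemma piso_integral (P : piso) (H : J -> \bar R) :
  measurable_fun setT H -> (forall x, (0 <= H x)%E) ->
  (\int[lambda]_(x in dom P) H (fw P x) = \int[lambda]_(y in cod P) H y)%E.
Proof.
move=> mH H0; have mf := @piso_fw _ _ _ _ P.
rewrite -(ge0_integral_mrestr _ (@piso_cod _ _ _ _ P))//.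
rewrite -(ge0_integral_mrestr _ (@piso_dom _ _ _ _ P))//; last first.
  exact: measurableT_comp.
rewrite -[LHS](@ge0_integral_pushforward _ _ _ _ _ _ mf _ setT)//.
apply: eq_measure_integral => A mA _; rewrite /= /pushforward /mrestr.
by rewrite setIC [in RHS]setIC; exact: piso_inv.
Qed.

End piso_theory.

Lemma measurable_mem (d : measure_display) (T : measurableType d) (A : set T) :
  measurable A -> measurable_fun setT (fun x => x \in A).
Proof.
move=> mA; apply: (measurable_fun_bool true); rewrite setTI.
by rewrite (_ : _ @^-1` _ = A)//; apply/seteqP; split => x /= => [/set_mem|/mem_set].
Qed.

(** * The mass transport principle *)

Section mass_transport.
Local Open Scope ereal_scope.
Context (d : measure_display) (J : measurableType d) (R : realType).
Variable lambda : {measure set J -> \bar R}.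

(** Each map is restricted to the points where no earlier one takes the same value; this set is
    Borel because the diagonal is. *)
Lemma piso_disjointify (P : nat -> piso lambda) :
  measurable [set p : J * J | p.1 = p.2] ->
  exists Q : nat -> piso lambda,
    (forall u v, (exists n, dom (P n) u /\ fw (P n) u = v) <->
                 (exists n, dom (Q n) u /\ fw (Q n) u = v)) /\
    (forall u n m, dom (Q n) u -> dom (Q m) u -> fw (Q n) u = fw (Q m) u ->
      n = m).
Proof.
move=> mdiag.
pose B n := [set u | forall k, (k < n)%N ->
  ~ (dom (P k) u /\ fw (P k) u = fw (P n) u)].
have mB n : measurable (B n).
  apply: measurable_forall => k; apply: measurable_impl.
    exact: measurable_cstP.
  apply: measurable_neg; apply: measurable_conj; first exact: piso_dom.
  apply: (measurable_preimage (f := fun u => (fw (P k) u, fw (P n) u)) _ mdiag).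
  by apply: measurable_fun_pair; exact: piso_fw.
exists (fun n => piso_restr (P n) (mB n)); split => [u v|u n m [un Bn] [um Bm] e].
- split => -[n [/= un nv]]; last by exists n; case: un.
  have ex : exists n, `[< dom (P n) u /\ fw (P n) u = v >].
    by exists n; exact/asboolP.
  case: (ex_minnP ex) => m /asboolP[um mv] mmin.
  exists m; split => //=; split => // k km [uk kv].
  have := mmin k; rewrite leqNgt km => H.
  by apply: notF; apply: H; apply/asboolP; rewrite kv mv.
- by have [nm|mn|//] := ltngtP n m; [case: (Bm _ nm)|case: (Bn _ mn)].
Qed.

Variables (P : nat -> piso lambda) (K : set (J * J)).
Hypothesis PK : forall u v, K (u, v) <-> exists n, dom (P n) u /\ fw (P n) u = v.
Hypothesis Puniq : forall u n m, dom (P n) u -> dom (P m) u ->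
  fw (P n) u = fw (P m) u -> n = m.

Lemma esum_fw (u : J) (f : J -> \bar R) : (forall v, 0 <= f v) ->
  \esum_(v in [set v | K (u, v)]) f v =
  \sum_(n <oo) (if u \in dom (P n) then f (fw (P n) u) else 0).
Proof.
move=> f0; rewrite (@reindex_esum _ _ _ [set n | dom (P n) u] _ (fun n => fw (P n) u)).
  rewrite esum_mkcond -nneseries_esumT.
    by apply: eq_eseriesr => n _; congr (if _ then _ else _);
      apply/idP/idP; rewrite !inE.
  by move=> n; case: ifP.
split.
- by move=> n /= un; apply/PK; exists n.
- by move=> n m; rewrite !inE => /= un um; exact: Puniq.
- by move=> v /= /PK[n [un <-]]; exists n.
Qed.

Lemma esum_bw (v : J) (f : J -> \bar R) : (forall u, 0 <= f u) ->
  \esum_(u in [set u | K (u, v)]) f u =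
  \sum_(n <oo) (if v \in cod (P n) then f (bw (P n) v) else 0).
Proof.
move=> f0; rewrite (@reindex_esum _ _ _ [set n | cod (P n) v] _ (fun n => bw (P n) v)).
  rewrite esum_mkcond -nneseries_esumT.
    by apply: eq_eseriesr => n _; congr (if _ then _ else _);
      apply/idP/idP; rewrite !inE.
  by move=> n; case: ifP.
split.
- by move=> n /= /piso_bwP[un nv]; apply/PK; exists n.
- move=> n m; rewrite !inE => /= /piso_bwP[un nv] /piso_bwP[um mv] e.
  by apply: (Puniq un); rewrite ?nv e.
- move=> u /= /PK[n [un <-]]; exists n; first by have [] := piso_fwP un.
  by have [_] := piso_fwP un.
Qed.

Lemma measurable_esum_section (F : J * J -> \bar R) :
  measurable_fun setT F -> (forall p, 0 <= F p) ->
  measurable_fun setT (fun u => \esum_(v in [set v | K (u, v)]) F (u, v)).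
Proof.
move=> mF F0; under eq_fun do rewrite esum_fw//.
apply: ge0_emeasurable_sum => n; first by move=> x _ _; case: ifP.
move=> _; apply: measurable_fun_ifT.
- exact/measurable_mem/piso_dom.
- apply: measurableT_comp => //; apply: measurable_fun_pair => //; exact: piso_fw.
- exact: measurable_cst.
Qed.

(** Both inner sums become series over [n], one along the maps [P n] and the other along their
    inverses. The integrals agree term by term because [P n] preserves [lambda]. *)
Theorem mass_transport (F : J * J -> \bar R) :
  measurable_fun setT F -> (forall p, 0 <= F p) ->
  \int[lambda]_u (\esum_(v in [set v | K (u, v)]) F (u, v)) =
  \int[lambda]_v (\esum_(u in [set u | K (u, v)]) F (u, v)).
Proof.
move=> mF F0.
have mif (A : set J) (G : J -> \bar R) : measurable A -> measurable_fun setT G ->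
    measurable_fun setT (fun u => if u \in A then G u else 0).
  move=> mA mG; apply: measurable_fun_ifT => //.
  exact: measurable_mem.
have mfw n : measurable_fun setT (fun u => F (u, fw (P n) u)).
  by apply: measurableT_comp => //; apply: measurable_fun_pair => //; exact: piso_fw.
have mbw n : measurable_fun setT (fun v => F (bw (P n) v, v)).
  by apply: measurableT_comp => //; apply: measurable_fun_pair => //; exact: piso_bw.
under eq_integral do rewrite esum_fw//.
under [RHS]eq_integral do rewrite esum_bw//.
rewrite !integral_nneseries//.
- apply: eq_eseriesr => n _.
  have H := @integral_mkcond _ _ _ lambda.
  rewrite -[LHS](H (dom (P n)) (fun u => F (u, fw (P n) u))).
  rewrite -[RHS](H (cod (P n)) (fun v => F (bw (P n) v, v))).
  rewrite -piso_integral//; apply: eq_integral => u; rewrite inE => /piso_fwP[_ ubw].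
  by rewrite ubw.
- by move=> n; apply: mif => //; exact: piso_cod.
- by move=> n v _; case: ifP.
- by move=> n; apply: mif => //; exact: piso_dom.
- by move=> n v _; case: ifP.
Qed.

End mass_transport.

(** * Measure-preserving structure of the edges *)

Definition image_measure (d1 d2 : measure_display) (T1 : measurableType d1)
  (T2 : measurableType d2) (R : realType) (m : {measure set T1 -> \bar R})
  (f : T1 -> T2) (mf : measurable_fun setT f) : {measure set T2 -> \bar R}.
Proof. by unshelve refine (pushforward m f). Defined.

Lemma counting_le_inj (R : realType) (T : choiceType) (A : set T) D
    (t : 'I_D.+1 -> T) : (counting A <= (D%:R : R)%:E)%E ->
  injective t -> ~ forall i, A (t i).
Proof.
move=> AD tinj tA; move: AD; rewrite /counting; case: asboolP => // fA.
rewrite lee_fin ler_nat => AD.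
have : (size (codom t) <= size (fset_set A))%N.
  apply: uniq_leq_size; first exact/injectiveP.
  by move=> y /codomP[i ->]; rewrite in_fset_set// inE.
by rewrite size_codom card_ord leqNgt ltnS AD.
Qed.

Section edge_isomorphisms.
Local Open Scope ereal_scope.
Context (d : measure_display) (J : measurableType d) (R : realType).
Variables (lambda : probability J R) (E : set (J * J)) (g : nat -> J -> J).
Hypothesis mE : measurable E.
Hypothesis symE : symmetric_set E.
Hypothesis mdiag : measurable [set p : J * J | p.1 = p.2].
Hypothesis mg : forall n, measurable_fun setT (g n).
Hypothesis Eg : forall x y, E (x, y) -> exists n, y = g n x.
Hypothesis mass_preserving : forall A B : set J, measurable A -> measurable B ->
  \int[lambda]_(x in A) deg R E B x = \int[lambda]_(x in B) deg R E A x.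
Hypothesis finite_degree : \int[lambda]_x deg R E setT x < +oo.

Let mpair n : measurable_fun setT (fun u => (u, g n u)).
Proof. exact: measurable_fun_pair. Qed.

Let meq (f h : J -> J) : measurable_fun setT f -> measurable_fun setT h ->
  measurable [set u | f u = h u].
Proof.
move=> mf mh.
exact: (measurable_preimage (measurable_fun_pair mf mh) mdiag).
Qed.

(** Minimality of the index lets every edge at [u] leave through exactly one [g n]. *)
Definition out_edge n := [set u | E (u, g n u) /\
  forall k, (k < n)%N -> g k u <> g n u].

Lemma measurable_out_edge n : measurable (out_edge n).
Proof.
apply: measurable_conj; first exact: (measurable_preimage (mpair n) mE).
apply: measurable_forall => k; apply: measurable_impl.
  exact: measurable_cstP.
by apply: measurable_neg; exact: meq.
Qed.

Lemma out_edge_ex u v : E (u, v) -> exists n, out_edge n u /\ g n u = v.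
Proof.
move=> Euv; have ex : exists n, `[< g n u = v >].
  by have [n ->] := Eg Euv; exists n; exact/asboolP.
case: (ex_minnP ex) => n /asboolP nv nmin; exists n; split => //.
split; first by rewrite nv.
move=> k kn kv; have := nmin k; rewrite leqNgt kn => H.
by apply: notF; apply: H; apply/asboolP; rewrite kv nv.
Qed.

Lemma out_edge_uniq u n m : out_edge n u -> out_edge m u -> g n u = g m u ->
  n = m.
Proof.
move=> [_ un] [_ um] e.
by have [nm|mn|//] := ltngtP n m; [case: (um _ nm)|case: (un _ mn)].
Qed.

Lemma deg_series B u :
  deg R E B u = \sum_(n <oo) (\1_[set u | out_edge n u /\ B (g n u)] u)%:E.
Proof.
rewrite /deg -esum_cst1.
rewrite (@reindex_esum _ _ _ [set n | out_edge n u /\ B (g n u)] _ (fun n => g n u)).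
  rewrite esum_mkcond -nneseries_esumT; last by move=> n; case: ifP.
  apply: eq_eseriesr => n _; rewrite indicE.
  have -> : (n \in [set n | out_edge n u /\ B (g n u)]) =
            (u \in [set u | out_edge n u /\ B (g n u)]).
    by apply/idP/idP; rewrite !inE.
  by case: ifP.
split.
- by move=> n /= [[]].
- by move=> n m; rewrite !inE => /= -[un _] [um _]; exact: out_edge_uniq.
- by move=> v /= [Bv /out_edge_ex[n [un nv]]]; exists n; rewrite /= ?nv.
Qed.

(** The edge measure before division by the average degree, written as a sum over the graphs of the
    [g n] so that its values on subsets of these graphs are explicit. *)
Definition edge_mass : {measure set (J * J) -> \bar R} :=
  mseries (fun n =>
    image_measure (mrestr lambda (measurable_out_edge n)) (mpair n)) 0.

Lemma edge_massX A B : measurable A -> measurable B ->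
  edge_mass (A `*` B) = \int[lambda]_(x in A) deg R E B x.
Proof.
move=> mA mB; under eq_integral do rewrite deg_series.
have mD n : measurable [set u | out_edge n u /\ B (g n u)].
  apply: measurable_conj; first exact: measurable_out_edge.
  exact: (measurable_preimage (mg n)).
rewrite integral_nneseries//; last first.
  by move=> n; apply: (measurable_funS measurableT) => //;
    apply/measurable_EFinP; exact: measurable_indic.
apply: eq_eseriesr => n _; rewrite integral_indic//= /pushforward /mrestr.
by congr (lambda _); apply/seteqP; split => u /=; tauto.
Qed.

Lemma measure_prod_unique (m1 m2 : {measure set (J * J) -> \bar R}) :
  (forall A B, measurable A -> measurable B -> m1 (A `*` B) = m2 (A `*` B)) ->
  m1 setT < +oo -> forall Z, measurable Z -> m1 Z = m2 Z.
Proof.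
move=> m12 m1T Z mZ.
apply: (measure_unique [set A `*` B | A in measurable & B in measurable]
  (fun=> setT)) => //.
- exact: measurable_prod_measurableType.
- move=> _ _ [A mA [B mB <-]] [A' mA' [B' mB' <-]].
  exists (A `&` A'); first exact: measurableI.
  by exists (B `&` B'); [exact: measurableI|rewrite setXI].
- by move=> n; exists setT => //; exists setT; rewrite // setXTT.
- by rewrite bigcup_const.
- by move=> _ [A mA [B mB <-]]; exact: m12.
Qed.

Let edge_mass_fin : edge_mass setT < +oo.
Proof. by rewrite -setXTT edge_massX. Qed.

(** On rectangles this is the defining identity of a graphing, and rectangles determine a finite
    measure. *)
Lemma edge_mass_swap Z : measurable Z ->
  edge_mass [set p | Z (p.2, p.1)] = edge_mass Z.
Proof.
move=> mZ; apply/esym; have msw := @measurable_swap _ _ J J.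
apply: (@measure_prod_unique edge_mass (image_measure edge_mass msw)) => //.
move=> A B mA mB; rewrite edge_massX// mass_preserving// -edge_massX//=.
by congr (edge_mass _); apply/seteqP; split => -[x y] [].
Qed.


(** Only the [n]-th term of the series contributes, as an edge leaves through a single index. *)
Lemma edge_mass_graph n (B : set J) Z : measurable B -> measurable Z ->
  (forall u, B u -> out_edge n u) ->
  (forall u v, Z (u, v) <-> B u /\ v = g n u) -> edge_mass Z = lambda B.
Proof.
move=> mB mZ BO ZB; rewrite /edge_mass /= /mseries.
rewrite (_ : \sum_(0 <= k <oo) _ =
    \sum_(k <oo) if k \in [set n] then lambda B else 0).
  rewrite nneseries_esumT; last by move=> k; case: ifP.
  by rewrite -esum_mkcond esum_fset ?fsbig_set1.
apply: eq_eseriesr => k _; rewrite /= /pushforward /mrestr; case: ifPn => [|kn].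
  rewrite inE => /= ->; congr (lambda _); apply/seteqP; split => u /=.
    by move=> [/ZB[]].
  by move=> Bu; split; [exact/ZB|exact: BO].
rewrite (_ : _ `&` _ = set0) ?measure0//; apply/seteqP; split => // u /=.
move=> [/ZB[Bu kn'] ku]; move: kn; rewrite notin_setE; apply => /=.
by apply: out_edge_uniq kn' => //; exact: BO.
Qed.

(* Numbering each edge at both endpoints makes [g i.1] invertible on
   [matched_edge i], with inverse [g i.2]. *)
Definition matched_edge (i : nat * nat) := [set u | out_edge i.1 u /\
  out_edge i.2 (g i.1 u) /\ g i.2 (g i.1 u) = u].

Lemma measurable_matched_edge i : measurable (matched_edge i).
Proof.
apply: measurable_conj; first exact: measurable_out_edge.
apply: measurable_conj; first exact: (measurable_preimage _ (measurable_out_edge _)).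
by apply: meq; [exact: measurableT_comp|exact: measurable_id].
Qed.

Lemma matched_edge_swap n m u :
  matched_edge (n, m) u -> matched_edge (m, n) (g n u) /\ g m (g n u) = u.
Proof. by move=> [/= un [um umn]]; rewrite /matched_edge /= umn. Qed.

Lemma matched_edge_ex u v : E (u, v) -> exists i, matched_edge i u /\ g i.1 u = v.
Proof.
move=> Euv; have [n [un nv]] := out_edge_ex Euv.
have [m [vm mu]] := out_edge_ex (symE Euv).
by exists (n, m); rewrite /matched_edge/= nv.
Qed.

(** Preservation of [lambda] comes from the symmetry of [edge_mass]: [Z] is the graph of the map
    over the points sent into [A]. Its mass is the measure of the source, and the mass of its
    transpose is the measure of the target. *)
Definition edge_piso (i : nat * nat) : piso lambda.
Proof.
case: i => n m.
exists (g n) (g m) (matched_edge (n, m)) (matched_edge (m, n)) => //.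
- exact: measurable_matched_edge.
- exact: measurable_matched_edge.
- by move=> u /matched_edge_swap.
- by move=> u /matched_edge_swap.
move=> A mA.
have mO i := measurable_matched_edge i.
have mOA : measurable [set u | matched_edge (n, m) u /\ A (g n u)].
  apply: measurable_conj; first exact: mO.
  exact: (measurable_preimage (mg n)).
pose Z := [set p : J * J | (matched_edge (n, m) p.1 /\ A (g n p.1)) /\ p.2 = g n p.1].
have mZ : measurable Z.
  apply: measurable_conj; first exact: (measurable_preimage (@measurable_fst _ _ J J) mOA).
  have mf : measurable_fun setT (fun p : J * J => (p.2, g n p.1)).
    apply: measurable_fun_pair; first exact: measurable_snd.
    by apply: measurableT_comp; [exact: mg|exact: measurable_fst].
  exact: (measurable_preimage mf mdiag).
rewrite -(@edge_mass_graph n _ Z mOA)//; last by move=> u [[]].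
rewrite -edge_mass_swap//; apply: (@edge_mass_graph m).
- by apply: measurable_conj => //; exact: mO.
- exact: (measurable_preimage (@measurable_swap _ _ J J) mZ).
- by move=> u [[]].
- move=> v u; rewrite /Z /=; split => [[[/matched_edge_swap[H e] Agu] ->]|].
    by rewrite e.
  by move=> [[/matched_edge_swap[H e] Av] ->]; rewrite e.
Defined.

Definition walk_piso (w : seq (nat * nat)) : piso lambda :=
  foldr (fun i Q => piso_comp (edge_piso i) Q) (piso_id lambda) w.

Lemma edge_pisoE i : (fw (edge_piso i) = g i.1) * (dom (edge_piso i) = matched_edge i).
Proof. by case: i. Qed.

Lemma component_walk_piso u v : component E u v <->
  exists w, dom (walk_piso w) u /\ fw (walk_piso w) u = v.
Proof.
split.
- move=> [p]; elim: p u => [|x p IH] u /=; first by move=> _ <-; exists [::].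
  move=> /andP[/asboolP/matched_edge_ex[i [iu iux]] xp] pv.
  have [w [wx wv]] := IH _ xp pv.
  by exists (i :: w); rewrite /= !edge_pisoE /= iux.
- move=> [w]; elim: w u => [|i w IH] u /=; first by move=> [_ <-]; exists [::].
  rewrite !edge_pisoE => -[[iu wu] wv].
  have [p up pv] := IH (g i.1 u) (conj wu wv).
  exists (g i.1 u :: p) => //=; rewrite up andbT; apply/asboolP.
  by case: iu => -[].
Qed.

(** A walk is described by the labels of its edges, and there are countably many label sequences.
    The maps along them reach the whole component and are then made disjoint. *)
Theorem component_enumeration : exists P : nat -> piso lambda,
  (forall u v, component E u v <-> exists n, dom (P n) u /\ fw (P n) u = v) /\
  (forall u n m, dom (P n) u -> dom (P m) u -> fw (P n) u = fw (P m) u -> n = m).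
Proof.
pose P n := if choice.unpickle n is Some w then walk_piso w else piso_id lambda.
have [Q [PQ Quniq]] := @piso_disjointify _ _ _ lambda P mdiag.
exists Q; split => // u v; rewrite -PQ; split.
- move=> /component_walk_piso[w wuv]; exists (choice.pickle w).
  by rewrite /P choice.pickleK.
- move=> [n]; rewrite /P; case: choice.unpickle => [w|] uv; apply/component_walk_piso.
    by exists w.
  by exists [::].
Qed.

(** A vertex incident with [S] has an edge of [S] leaving through some [g n]; the bound is countable
    subadditivity over [n]. *)
Lemma edge_mass_ge_support S : measurable S -> S `<=` E ->
  measurable [set u | exists v, S (u, v)] /\
  lambda [set u | exists v, S (u, v)] <= edge_mass S.
Proof.
move=> mS SE.
have mSn n : measurable [set u | S (u, g n u) /\ out_edge n u].
  apply: measurable_conj; last exact: measurable_out_edge.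
  exact: (measurable_preimage (mpair n)).
have SU : [set u | exists v, S (u, v)] =
    \bigcup_n [set u | S (u, g n u) /\ out_edge n u].
  apply/seteqP; split => [u /= [v Suv]|u [n _ [/= Sun _]]]; last by exists (g n u).
  by have [n [un nv]] := out_edge_ex (SE _ Suv); exists n => //=; rewrite nv.
rewrite SU; split; first exact: bigcupT_measurable.
have := @measure_sigma_subadditive _ _ _ lambda _
  (fun n => [set u | S (u, g n u) /\ out_edge n u]) mSn.
by apply => //; exact: bigcupT_measurable.
Qed.

End edge_isomorphisms.

(** * Components *)

Section components.
Context (J : choiceType).
Implicit Types (X Y : set (J * J)) (u v : J).

Definition walk X k u v := exists p : seq J,
  [/\ path (fun x y => `[< X (x, y) >]) u p, last u p = v & size p = k].

Lemma walk0 X u v : walk X 0 u v <-> u = v.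
Proof.
by split=> [[p [_ <- /size0nil ->]]|->]; [|exists [::]].
Qed.

Lemma walkS X k u v : walk X k.+1 u v <-> exists y, X (u, y) /\ walk X k y v.
Proof.
split.
  move=> [[|y p] [//= /andP[/asboolP uy yp] pv [pk]]].
  by exists y; split => //; exists p.
move=> [y [uy [p [yp pv pk]]]]; exists (y :: p); split => //=; last by rewrite pk.
by rewrite yp andbT; exact/asboolP.
Qed.

Lemma walk1 X u v : X (u, v) -> walk X 1 u v.
Proof. by move=> uv; apply/walkS; exists v; split => //; exact/walk0. Qed.

Lemma walk_cat X k l u v w : walk X k u v -> walk X l v w -> walk X (k + l) u w.
Proof.
elim: k u => [|k IH] u; first by move=> /walk0 ->.
move=> /walkS[y [uy yv]] vw; rewrite addSn; apply/walkS; exists y; split => //.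
exact: IH.
Qed.

Lemma walk_sym X k u v : symmetric_set X -> walk X k u v -> walk X k v u.
Proof.
move=> sX; elim: k u => [|k IH] u; first by move=> /walk0 ->; exact/walk0.
move=> /walkS[y [uy yv]]; rewrite -addn1; apply: walk_cat (IH _ yv) _.
exact/walk1/sX.
Qed.

Lemma walk_sub X Y k u v : X `<=` Y -> walk X k u v -> walk Y k u v.
Proof.
move=> XY; elim: k u => [|k IH] u; first by move=> /walk0 ->; exact/walk0.
by move=> /walkS[y [uy yv]]; apply/walkS; exists y; split; [exact: XY|exact: IH].
Qed.

Lemma componentE X u v : component X u v <-> exists k, walk X k u v.
Proof.
split; first by move=> [p up pv]; exists (size p); exists p.
by move=> [k [p [up pv _]]]; exists p.
Qed.

Lemma component_refl X u : component X u u.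
Proof. by exists [::]. Qed.

Lemma component_edge X u v : X (u, v) -> component X u v.
Proof. by move=> /walk1 uv; apply/componentE; exists 1. Qed.

Lemma component_trans X u v w :
  component X u v -> component X v w -> component X u w.
Proof.
move=> /componentE[k uv] /componentE[l vw]; apply/componentE; exists (k + l)%N.
exact: walk_cat uv vw.
Qed.

Lemma component_sym X u v : symmetric_set X -> component X u v -> component X v u.
Proof.
by move=> sX /componentE[k uv]; apply/componentE; exists k; exact: walk_sym.
Qed.

Lemma component_eq X u v : symmetric_set X -> component X u v ->
  component X u = component X v.
Proof.
move=> sX uv; apply/seteqP; split => w; last exact: component_trans.
by apply: component_trans; exact: component_sym.
Qed.

Lemma component_sub X Y u : X `<=` Y -> component X u `<=` component Y u.
Proof.
by move=> XY v /componentE[k uv]; apply/componentE; exists k; exact: walk_sub uv.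
Qed.

Lemma component_closed X (S : set J) u : S u ->
  (forall x y, S x -> X (x, y) -> S y) -> component X u `<=` S.
Proof.
move=> Su Sc v /componentE[k]; elim: k u Su => [|k IH] u Su.
  by move=> /walk0 <-.
by move=> /walkS[y [uy]]; apply: IH; exact: Sc uy.
Qed.

(** A walk has finitely many edges, so it already lies in one of the increasing sets. *)
Lemma component_bigcup (X : (set (J * J))^nat) u v :
  (forall n, X n `<=` X n.+1) -> component (\bigcup_n X n) u v ->
  exists n, component (X n) u v.
Proof.
move=> Xnd; have Xle m n : (m <= n)%N -> X m `<=` X n.
  by move=> /subnKC <-; elim: (n - m)%N => [|k IH]; rewrite ?addn0// addnS;
    exact: subset_trans (Xnd _).
move=> /componentE[k]; elim: k u => [|k IH] u.
  by move=> /walk0 ->; exists 0%N; exact: component_refl.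
move=> /walkS[y [[m _ uy] /IH[n yv]]]; exists (maxn m n).
apply: component_trans (component_sub (Xle _ _ (leq_maxr _ _)) yv).
by apply: component_edge; apply: Xle uy; exact: leq_maxl.
Qed.

(** [None] stands for infinity. The type of values is countable, so any function of the size is
    measurable once the level sets are. *)
Definition osize (A : set J) : option nat :=
  if `[< finite_set A >] then Some #|` fset_set A| else None.

Definition csize k (A : set J) : nat :=
  if osize A is Some n then minn n k else k.

Lemma csize_le k A : (csize k A <= k)%N.
Proof. by rewrite /csize; case: osize => // n; exact: geq_minr. Qed.

(** Together with [csize_ge], this characterises the truncated size, for finite and infinite sets
    alike, as the largest length up to [k] of a duplicate-free list in [A]. *)
Lemma csize_seq k (A : set J) : exists s : seq J,
  [/\ uniq s, forall x, x \in s -> A x & size s = csize k A].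
Proof.
rewrite /csize /osize; case: asboolP => [fA|/(@infinite_set_fset _ _ k)[B BA kB]].
  exists (take k (fset_set A)); split.
  - by rewrite take_uniq// fset_uniq.
  - by move=> x /mem_take; rewrite in_fset_set// inE.
  - by rewrite size_take_min minnC.
exists (take k B); split; first by rewrite take_uniq// fset_uniq.
  by move=> x /mem_take/BA.
by rewrite size_take_min (minn_idPl kB).
Qed.

Lemma csize_ge k (A : set J) (s : seq J) : uniq s ->
  (forall x, x \in s -> A x) -> (size s <= k)%N -> (size s <= csize k A)%N.
Proof.
move=> us sA sk; rewrite /csize /osize; case: asboolP => // fA.
rewrite leq_min sk andbT; apply: uniq_leq_size => // x /sA Ax.
by rewrite in_fset_set// inE.
Qed.

Lemma csize_mono k (A B : set J) : A `<=` B -> (csize k A <= csize k B)%N.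
Proof.
move=> AB; have [s [us sA sk]] := csize_seq k A; rewrite -sk.
by apply: csize_ge => //; [move=> x /sA/AB|rewrite sk csize_le].
Qed.

Lemma csize_ltP k (A : set J) : (csize k A < k)%N ->
  finite_set A /\ csize k A = #|` fset_set A|.
Proof.
rewrite /csize /osize; case: asboolP => [fA|]; last by rewrite ltnn.
by rewrite gtn_min ltnn orbF => /ltnW/minn_idPl ->.
Qed.

Lemma csize_gt0 k (A : set J) x : (0 < k)%N -> A x -> (0 < csize k A)%N.
Proof.
move=> k0 Ax; apply: (@csize_ge k A [:: x]) => // y.
by rewrite inE => /eqP ->.
Qed.

Lemma csizeU k (A B : set J) : (csize k A < k)%N -> (csize k B < k)%N ->
  A `&` B = set0 -> csize k (A `|` B) = minn (csize k A + csize k B) k.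
Proof.
move=> /csize_ltP[fA ->] /csize_ltP[fB ->] AB0.
rewrite /csize /osize asboolT ?finite_setU//; congr minn.
rewrite fset_setU// cardfsU -fset_setI// AB0 fset_set0 cardfs0 subn0//.
Qed.

(** A path without repetition visits distinct vertices of the component, which has fewer than [k] of
    them. *)
Lemma csize_component_path k X u v : (csize k (component X u) < k)%N ->
  component X u v -> exists2 l, (l < k)%N & walk X l u v.
Proof.
move=> uk [p up pv]; case/shortenP: up pv => q uq unq _ qv.
exists (size q); last by exists q.
have := @csize_ge k (component X u) (take k (u :: q)); rewrite take_uniq//.
move=> /(_ isT) H; move: uk; rewrite ltnNge => /negP uk; rewrite ltnNge.
apply/negP => kq; apply: uk; rewrite -[X in (X <= _)%N](@size_takel k _ (u :: q)).
  apply: H; last by rewrite size_take_min geq_minl.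
  move=> x /mem_take; rewrite inE => /predU1P[->|xq]; first exact: component_refl.
  move: uq; case/splitPr: xq => q1 q2; rewrite cat_path /= => /and3P[uq1 q1x _].
  by exists (rcons q1 x); rewrite ?rcons_path ?uq1 ?last_rcons.
exact: leqW.
Qed.

(** The finitely many elements that witness the truncated size of the union all lie in some
    [A N]. *)
Lemma csize_bigcup k (A : (set J)^nat) : (forall n, A n `<=` A n.+1) ->
  exists N, forall n, (N <= n)%N -> csize k (A n) = csize k (\bigcup_n A n).
Proof.
move=> And; have Ale m n : (m <= n)%N -> A m `<=` A n.
  by move=> /subnKC <-; elim: (n - m)%N => [|l IH]; rewrite ?addn0// addnS;
    exact: subset_trans (And _).
have [s [us sA sk]] := csize_seq k (\bigcup_n A n).
have [N sN] : exists N, forall x, x \in s -> A N x.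
  elim: s {us sk} sA => [|x s IH] sA; first by exists 0%N.
  have [n _ nx] := sA x (mem_head _ _).
  have [|N sN] := IH; first by move=> y ys; apply: sA; rewrite inE ys orbT.
  exists (maxn n N) => y; rewrite inE => /predU1P[->|/sN].
    by apply: Ale nx; exact: leq_maxl.
  by apply: Ale; exact: leq_maxr.
exists N => n Nn; apply/eqP; rewrite eqn_leq csize_mono/=; last exact: bigcup_sup.
rewrite -sk; apply: csize_ge => //; last by rewrite sk csize_le.
by move=> x /sN; exact: Ale.
Qed.

Lemma esum_csize (R : realType) k (A : set J) (r : R) : (csize k A < k)%N ->
  (0 <= r)%R -> \esum_(x in A) r%:E = ((csize k A)%:R * r)%:E.
Proof.
move=> /csize_ltP[fA ->] r0; rewrite esum_fset// fsbig_finite//= sumEFin.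
by rewrite big_const_seq iter_addr_0 count_predT mulr_natl.
Qed.

Lemma esum_osize (R : realType) (A : set J) :
  (\esum_(x in A) (1 : \bar R))%E = if osize A is Some n then n%:R%:E else +oo%E.
Proof. by rewrite esum_cst1 /counting /osize; case: asboolP. Qed.

End components.

(** * Measurability of component sizes, and sparse families of edges *)

Section component_measurability.
Context (d : measure_display) (J : measurableType d) (R : realType).
Variables (lambda : {measure set J -> \bar R}) (E : set (J * J)).
Variable (g : nat -> J -> J).
Hypothesis mdiag : measurable [set p : J * J | p.1 = p.2].
Hypothesis mg : forall n, measurable_fun setT (g n).
Hypothesis Eg : forall x y, E (x, y) -> exists n, y = g n x.
Variable P : nat -> piso lambda.
Hypothesis PE : forall u v, component E u v <->
  exists n, dom (P n) u /\ fw (P n) u = v.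
Hypothesis Puniq : forall u n m, dom (P n) u -> dom (P m) u ->
  fw (P n) u = fw (P m) u -> n = m.
Implicit Types X : set (J * J).

Lemma measurable_walk X k : measurable X -> X `<=` E ->
  measurable [set p : J * J | walk X k p.1 p.2].
Proof.
move=> mX XE; elim: k => [|k IH].
  rewrite (_ : [set p | _] = [set p | p.1 = p.2])//.
  by apply/seteqP; split => p /=; [move=> /walk0|move=> ?; exact/walk0].
rewrite (_ : [set p | _] = [set p | exists n, X (p.1, g n p.1) /\
    walk X k (g n p.1) p.2]).
  have mg1 n : measurable_fun setT (fun p : J * J => g n p.1).
    by apply: measurableT_comp; [exact: mg|exact: measurable_fst].
  apply: measurable_exists => n; apply: measurable_conj.
    exact: (measurable_preimage (measurable_fun_pair measurable_fst (mg1 n)) mX).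
  exact: (measurable_preimage (measurable_fun_pair (mg1 n) measurable_snd) IH).
apply/seteqP; split => p /=.
  move=> /walkS[y [uy yv]]; have [n yn] := Eg (XE _ uy).
  by exists n; rewrite -yn.
by move=> [n [uy yv]]; apply/walkS; exists (g n p.1).
Qed.

Lemma measurable_component X : measurable X -> X `<=` E ->
  measurable [set p : J * J | component X p.1 p.2].
Proof.
move=> mX XE.
rewrite (_ : [set p | _] = [set p | exists k, walk X k p.1 p.2]).
  by apply: measurable_exists => k; exact: measurable_walk.
by apply/seteqP; split => p /=; [move=> /componentE|move=> ?; exact/componentE].
Qed.

(** The size is the sum, over the component in the larger graph [E], of the indicator of being
    connected in [X]. The maps [P n] enumerate that component, so the sum is measurable. *)
Lemma measurable_osize X o : measurable X -> X `<=` E ->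
  measurable [set u | osize (component X u) = o].
Proof.
move=> mX XE; pose K := [set p : J * J | component X p.1 p.2].
have mK : measurable K by exact: measurable_component.
have sE u : (\esum_(v in [set v | component E u v]) (\1_K (u, v) : R)%:E =
    if osize (component X u) is Some n then n%:R%:E else +oo)%E.
  rewrite -esum_osize.
  transitivity (\esum_(v in [set v | component E u v] `&` component X u) (1 : \bar R))%E.
    rewrite esum_mkcondr; apply: eq_esum => v _; rewrite indicE.
    have -> : ((u, v) \in K) = (v \in component X u).
      by apply/idP/idP; rewrite !inE.
    by case: ifP.
  congr esum; apply/seteqP; split => v /=; first by case.
  by move=> uv; split => //; exact: component_sub XE _ uv.
have ms : measurable_fun setT (fun u =>
    \esum_(v in [set v | component E u v]) (\1_K (u, v) : R)%:E)%E.
  apply: (measurable_esum_section (P := P) (K := [set p | component E p.1 p.2])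
    _ _ (F := fun p => (\1_K p)%:E)) => //.
  - by apply/measurable_EFinP; exact: measurable_indic.
have mSome n : measurable [set u | osize (component X u) = Some n].
  rewrite (_ : [set u | _] = [set u | [set (n%:R%:E : \bar R)]
      (\esum_(v in [set v | component E u v]) (\1_K (u, v) : R)%:E)%E]).
    exact: (measurable_preimage ms (emeasurable_set1 _)).
  apply/seteqP; split => u /=; rewrite sE; first by move=> ->.
  by case: osize => // m [] /eqP; rewrite eqr_nat => /eqP ->.
case: o => [n|]; first exact: mSome.
rewrite (_ : [set u | _] = [set u | forall n, ~ osize (component X u) = Some n]).
  by apply: measurable_forall => n; apply: measurable_neg; exact: mSome.
by apply/seteqP; split => u /=; [move=> ->|case: osize => // n /(_ n)].
Qed.

Lemma measurable_fun_osize (h : option nat -> R) X : measurable X -> X `<=` E ->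
  measurable_fun setT (fun u => h (osize (component X u))).
Proof.
move=> mX XE _ B mB; rewrite setTI.
rewrite (_ : _ @^-1` B = [set u | exists o, osize (component X u) = o /\ B (h o)]).
  apply: measurable_exists => o; apply: measurable_conj.
    exact: measurable_osize.
  exact: measurable_cstP.
apply/seteqP; split => u /=; last by move=> [s [<-]].
by exists (osize (component X u)).
Qed.

Section coloring.
Context (cl : nat -> J -> J -> Prop) (q : nat -> J) (Q : polish cl q).
Hypothesis mE : measurable E.
Hypothesis finE : forall x, finite_set [set y | E (x, y)].

Lemma finite_walk k x : finite_set [set y | walk E k x y].
Proof.
elim: k x => [|k IH] x.
  rewrite (_ : [set y | _] = [set x]); first exact: finite_set1.
  by apply/seteqP; split => y /=; [move=> /walk0|move=> ->; exact/walk0].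
rewrite (_ : [set y | _] = \bigcup_(z in [set z | E (x, z)]) [set y | walk E k z y]).
  exact: bigcup_finite.
apply/seteqP; split => y /=; first by move=> /walkS[z [xz zy]]; exists z.
by move=> [z xz zy]; apply/walkS; exists z.
Qed.

(* Every vertex is in a ball containing no other point within distance [r],
   and there are countably many balls. *)
Lemma separated_cover r : exists (A : nat -> set J) (h : nat -> J -> J),
  [/\ forall n, measurable (A n), forall n, measurable_fun setT (h n),
      forall n x x' k, A n x -> A n x' -> (k <= r)%N -> walk E k x x' -> x = x' &
      forall x y, E (x, y) -> exists n, A n x /\ y = h n x].
Proof.
pose U ni := [set x | cl ni.1 (q ni.2) x] : set J.
have mU ni : measurable (U ni) by exact: (cl_measurable Q).
(* Quantifying over the maps [P j] instead of all points keeps the condition countable; [AP]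
   restores the plain form. *)
pose A ni := [set x | U ni x /\ forall k, (k <= r)%N -> forall j, dom (P j) x ->
  walk E k x (fw (P j) x) -> U ni (fw (P j) x) -> x = fw (P j) x].
have AP ni x : A ni x <-> U ni x /\ forall k y, (k <= r)%N -> walk E k x y ->
    U ni y -> x = y.
  split => -[Ux H]; split => // k; last by move=> kr j _ xy Uy; exact: H xy Uy.
  move=> y kr xy Uy; have /PE[j [xj jy]] : component E x y by apply/componentE; exists k.
  by rewrite -jy; apply: (H k) => //; rewrite jy.
have mA ni : measurable (A ni).
  apply: measurable_conj; first exact: mU.
  have mfw j := @piso_fw _ _ _ _ (P j).
  apply: measurable_forall => k; apply: measurable_impl.
    exact: measurable_cstP.
  apply: measurable_forall => j; apply: measurable_impl; first exact: piso_dom.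
  apply: measurable_impl.
    apply: (measurable_preimage (measurable_fun_pair (@measurable_id _ J setT) (mfw j))
      (measurable_walk k mE _)) => //.
  apply: measurable_impl; first exact: (measurable_preimage (mfw j)).
  exact: (measurable_preimage (measurable_fun_pair (@measurable_id _ J setT) (mfw j)) mdiag).
have cover x : exists ni, A ni x.
  have fW : finite_set (\bigcup_(k in `I_r.+1) [set y | walk E k x y]).
    by apply: bigcup_finite => // k _; exact: finite_walk.
  have far y : exists n, cl n x y -> x = y.
    apply: contrapT => H; apply: (H); exists 0%N => _; apply: (cl_sep Q) => n.
    by apply: contrapT => xy; apply: H; exists n.
  have {far}[f fP] := choice far.
  have [n nf] : exists n, forall y, y \in fset_set (\bigcup_(k in `I_r.+1)
      [set y | walk E k x y]) -> (f y <= n)%N.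
    exists (\max_(y <- fset_set (\bigcup_(k in `I_r.+1) [set y | walk E k x y])) f y)%N.
    by move=> y yW; exact: leq_bigmax_seq.
  (* The radius [2^-(n+1)] is used because two points of such a ball are within [2^-n], the distance
     that isolates [x] from the finitely many points reached by walks of length at most [r]. *)
  have [i xi] := cl_dense Q n.+1 x; exists (n.+1, i); apply/AP; split => //.
  move=> k y kr xy yi; apply: fP; apply: (cl_le Q (nf y _)).
    by rewrite in_fset_set// inE; exists k.
  exact: (cl_tri Q) (cl_sym Q xi) yi.
exists (fun n =>
  if choice.unpickle n : option (nat * nat * nat) is Some (ni, j) then A ni
  else set0).
exists (fun n =>
  if choice.unpickle n : option (nat * nat * nat) is Some (ni, j) then g j
  else id).
split.
- by move=> n; case: choice.unpickle => [[ni j]|].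
- by move=> n; case: choice.unpickle => [[ni j]|].
- move=> n x x' k; case: choice.unpickle => [[ni j]|//].
  by move=> /AP[_ H] /AP[Ux' _] kr; move=> /(H _ _ kr); exact.
- move=> x y /Eg[j yj]; have [ni xni] := cover x.
  by exists (choice.pickle ((ni, j) : nat * nat * nat)); rewrite choice.pickleK.
Qed.

End coloring.

End component_measurability.

(** * Adding a matching *)

Section matching_loss.
Context (J : choiceType) (R : realType).
Variables (E : set (J * J)) (k : nat) (A : set J) (h : J -> J).
Hypothesis symE : symmetric_set E.
Hypothesis k0 : (0 < k)%N.
Hypothesis AE : forall x, A x -> E (x, h x).
(** The distance leaves room for a walk of fewer than [k] steps in a small component with one edge
    of the matching at either end. *)
Hypothesis sepA : forall x x' l, A x -> A x' -> (l <= k.+2)%N ->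
  walk E l x x' -> x = x'.
Implicit Types X Z : set (J * J).

Definition inv_csize X u : R := (csize k (component X u))%:R^-1.

Definition matching := [set p : J * J |
  (A p.1 /\ p.2 = h p.1) \/ (A p.2 /\ p.1 = h p.2)].

Lemma matching_sym : symmetric_set matching.
Proof. by move=> x y [|]; [right|left]. Qed.

Lemma matching_sub : matching `<=` E.
Proof.
by move=> [x y] [/= [Ax ->]|/= [Ay ->]]; [exact: AE|exact/symE/AE].
Qed.

Definition drop_csize X u := inv_csize X u - inv_csize (X `|` matching) u.

(** The vertices whose drop is charged to the edge at [x]. *)
Definition side X x := component X x `|` component X (h x).

Lemma inv_csize_anti X Z u : Z `<=` X -> inv_csize X u <= inv_csize Z u.
Proof.
move=> ZX; have c0 : (0 < csize k (component Z u))%N.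
  by apply: csize_gt0 k0 _; exact: component_refl.
have cc := @csize_mono _ k _ _ (component_sub (u := u) ZX).
by rewrite lef_pV2 ?posrE ?ltr0n ?ler_nat// (leq_trans c0).
Qed.

Lemma drop_csize_ge0 X u : 0 <= drop_csize X u.
Proof. by rewrite subr_ge0 inv_csize_anti//; exact: subsetUl. Qed.

(** A truncated size that has reached [k] cannot grow any more. *)
Lemma drop_csize_small X u : drop_csize X u <> 0 ->
  (csize k (component X u) < k)%N.
Proof.
rewrite ltn_neqAle csize_le andbT => H; apply/eqP => ck; apply: H.
have cW : csize k (component (X `|` matching) u) = k.
  apply/eqP; rewrite eqn_leq csize_le -{1}ck; apply: csize_mono.
  by apply: component_sub; exact: subsetUl.
by rewrite /drop_csize /inv_csize cW ck subrr.
Qed.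

Section fixed_edges.
Variable X : set (J * J).
Hypothesis symX : symmetric_set X.
Hypothesis XE : X `<=` E.
Let W := X `|` matching.

Let symW : symmetric_set W.
Proof. by move=> x y [/symX|/matching_sym]; [left|right]. Qed.

Let XW u : component X u `<=` component W u.
Proof. by apply: component_sub; exact: subsetUl. Qed.

Let Wh x : A x -> component W x (h x).
Proof. by move=> Ax; apply: component_edge; right; left. Qed.

Let side_sub x : A x -> side X x `<=` component W x.
Proof.
move=> Ax u [/XW//|/XW]; apply: component_trans; exact: Wh.
Qed.

(** Both components being small, each vertex of [side X x] is within [k] steps of [x]. By [sepA] no
    other edge of the matching touches it, so it is closed under the edges of [W]. *)
Lemma component_matching x : A x -> (csize k (component X x) < k)%N ->
  (csize k (component X (h x)) < k)%N -> component W x = side X x.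
Proof.
move=> Ax cx chx; apply/seteqP; split; last exact: side_sub.
apply: component_closed; first by left; exact: component_refl.
move=> p p' xp; have [l [lk xl]] : exists l, (l <= k)%N /\ walk E l x p.
  case: xp => [/(csize_component_path cx)|/(csize_component_path chx)] [l lk xp].
    by exists l; split; [exact: ltnW|exact: walk_sub xp].
  exists l.+1; split => //; apply/walkS; exists (h x); split; first exact: AE.
  exact: walk_sub xp.
case=> [pp'|].
  by case: xp => [xp|xp]; [left|right]; apply: component_trans xp _;
    exact: component_edge.
case=> [[/= Ap p'h]|[/= Ap' ph]].
- rewrite p'h; have <- : x = p by apply: sepA xl => //; lia.
  by right; exact: component_refl.
- have -> : p' = x.
    apply/esym/(sepA (l := (l + 1)%N)) => //; first lia.
    by apply: walk_cat xl _; apply/walk1/symE; rewrite ph; exact: AE.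
  by left; exact: component_refl.
Qed.

(** A component touched by no edge of the matching remains a component in [W]. *)
Lemma drop_csize_side_ex u : drop_csize X u <> 0 -> exists x, A x /\ side X x u.
Proof.
move=> H; apply: contrapT => nside; apply: H.
suff e : component W u = component X u.
  by rewrite /drop_csize /inv_csize -/W e subrr.
apply/seteqP; split => //; apply: component_closed; first exact: component_refl.
move=> p p' up [pp'|]; first by apply: component_trans up _; exact: component_edge.
case=> [[/= Ap p'h]|[/= Ap' ph]]; exfalso; apply: nside.
- by exists p; split => //; left; exact: component_sym.
- by exists p'; split => //; right; rewrite -ph; exact: component_sym.
Qed.

(** The component of [u] is small, so two points of [A] whose edges touch it are joined by a walk of
    at most [k + 1] steps in [E]. *)
Lemma drop_csize_side_uniq u x x' : drop_csize X u <> 0 ->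
  A x -> side X x u -> A x' -> side X x' u -> x = x'.
Proof.
move=> /drop_csize_small cu Ax xu Ax' x'u.
have end_ex y : A y -> side X y u -> exists z l,
    [/\ (l <= 1)%N, walk E l y z & component X u z].
  move=> Ay [/component_sym yu|/component_sym yu].
    by exists y, 0%N; split => //; [exact/walk0|exact: yu].
  by exists (h y), 1%N; split => //; [exact/walk1/AE|exact: yu].
have [z [l [l1 xz uz]]] := end_ex _ Ax xu.
have [z' [l' [l'1 xz' uz']]] := end_ex _ Ax' x'u.
rewrite (component_eq symX uz) in cu uz'.
have [m mk zz'] := csize_component_path cu uz'.
apply: (sepA (l := (l + (m + l'))%N)) => //; first lia.
apply: walk_cat xz _; apply: walk_cat (walk_sub XE zz') _.
exact: walk_sym.
Qed.

(** A nonzero drop is charged to exactly one edge, so at most one term of the sum is nonzero. *)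
Lemma esum_drop_csize_side u :
  (\esum_(x in [set x | component E x u])
     (if `[< A x /\ side X x u >] then (drop_csize X u)%:E else 0) =
  (drop_csize X u)%:E)%E.
Proof.
have [->|/eqP u0] := eqVneq (drop_csize X u) 0.
  by apply: esum1 => x _; case: ifP.
have [x [Ax xu]] := drop_csize_side_ex u0.
transitivity (\esum_(y in [set y | component E y u] `&` [set x])
    (drop_csize X u)%:E)%E.
  rewrite esum_mkcondr; apply: eq_esum => y yu; congr (if _ then _ else _).
  apply/asboolP/idP; rewrite inE /=; last by move=> ->.
  by move=> [Ay yu']; exact: drop_csize_side_uniq yu' Ax xu.
rewrite (_ : _ `&` _ = [set x]).
  by rewrite esum_set1// lee_fin drop_csize_ge0.
apply/seteqP; split => y /= => [[]//|->]; split => //.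
case: xu => [|/(component_sub XE)]; first exact: component_sub.
by apply: component_trans; exact/component_edge/AE.
Qed.

(** A nonzero drop requires a small component, and [component_matching] then shows that the
    component does not change. *)
Lemma loss_same x : A x -> component X x (h x) ->
  (\esum_(u in side X x) (drop_csize X u)%:E = 0)%E.
Proof.
move=> Ax xh; apply: esum1 => u xu; congr (_%:E); apply: contrapT => u0.
have cu := drop_csize_small u0.
have xu' : component X x u by case: xu => //; exact: component_trans.
rewrite -(component_eq symX xu') in cu.
apply: u0; rewrite /drop_csize /inv_csize -/W.
rewrite -(component_eq symW (XW xu')) -(component_eq symX xu').
rewrite component_matching//; last by rewrite -(component_eq symX xh).
by rewrite /side -(component_eq symX xh) setUid subrr.
Qed.

(** With [c] the truncated size after merging, a component of size [v < k] contributes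
    [v (1/v - 1/c) = 1 - v/c]. If [v = k], possibly for an infinite component, then [c = k] and the
    contribution is [0], in accordance with the same formula. *)
Lemma loss_distinct x : A x -> ~ component X x (h x) ->
  let n := (csize k (component X x) + csize k (component X (h x)))%N in
  (\esum_(u in side X x) (drop_csize X u)%:E = (2 - n%:R / (minn n k)%:R)%:E)%E.
Proof.
move=> Ax nxh; set a := csize k (component X x).
set b := csize k (component X (h x)); move=> n; pose c := minn n k.
have disj : component X x `&` component X (h x) = set0.
  apply/seteqP; split => // u [xu hu]; apply: nxh.
  exact: component_trans xu (component_sym symX hu).
have a0 : (0 < a)%N by apply: csize_gt0 k0 _; exact: component_refl.
have b0 : (0 < b)%N by apply: csize_gt0 k0 _; exact: component_refl.
have c0 : (0 < c)%N by rewrite leq_min k0 andbT /n addn_gt0 a0.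
have ak : (a <= k)%N by exact: csize_le.
have bk : (b <= k)%N by exact: csize_le.
have cW : csize k (component W x) = c.
  have aW : (a <= csize k (component W x))%N by apply: csize_mono; exact: XW.
  have bW : (b <= csize k (component W x))%N.
    by apply: csize_mono; apply: subset_trans (side_sub Ax); exact: subsetUr.
  have Wk := csize_le k (component W x).
  have [ak'|ak'] := ltnP a k; last by rewrite /c /n; lia.
  have [bk'|bk'] := ltnP b k; last by rewrite /c /n; lia.
  by rewrite component_matching// csizeU.
have dropE u y (v := csize k (component X y)) : component W x y ->
    component X y u -> drop_csize X u = v%:R^-1 - c%:R^-1.
  move=> xy yu; rewrite /drop_csize /inv_csize -/W -(component_eq symX yu) -/v.
  by rewrite -(component_eq symW (XW yu)) -(component_eq symW xy) cW.
have sumE y (v := csize k (component X y)) : component W x y -> (v <= c)%N ->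
    (\esum_(u in component X y) (drop_csize X u)%:E = (1 - v%:R / c%:R)%:E)%E.
  move=> xy vc.
  have v0 : (0 < v)%N by apply: csize_gt0 k0 _; exact: component_refl.
  rewrite (eq_esum (b := fun=> (v%:R^-1 - c%:R^-1)%:E)); last first.
    by move=> u yu; rewrite (dropE u y).
  have [vk|kv] := ltnP v k.
    rewrite (@esum_csize _ _ k)//; last first.
      by rewrite subr_ge0 lef_pV2 ?posrE ?ltr0n ?ler_nat.
    by rewrite mulrBr divff// pnatr_eq0 -lt0n.
  have -> : v = c by have := geq_minr n k; rewrite -/c; lia.
  by rewrite subrr esum1// divff ?subrr// pnatr_eq0 -lt0n.
rewrite (esumID (component X x)); last first.
  by move=> u _; rewrite lee_fin drop_csize_ge0.
rewrite (_ : side X x `&` component X x = component X x); last first.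
  by apply/seteqP; split => u /=; [case|move=> xu; split => //; left].
rewrite (_ : side X x `&` ~` component X x = component X (h x)); last first.
  apply/seteqP; split => u /=; first by case=> -[].
  move=> hu; split; first by right.
  by move=> xu; suff : set0 u by []; rewrite -disj.
rewrite !sumE -/a -/b; last 4 first.
- exact: Wh.
- by rewrite /c /n; lia.
- exact: component_refl.
- by rewrite /c /n; lia.
by rewrite -EFinD /n natrD; congr (_%:E); rewrite -/c; lra.
Qed.

End fixed_edges.

(** More edges either connect [x] to [h x], making the loss [0], or enlarge the two truncated sizes;
    and [n / min(n,k)] is nondecreasing in [n]. *)
Lemma loss_anti X Z x : symmetric_set X -> X `<=` E -> symmetric_set Z ->
  Z `<=` X -> A x ->
  (\esum_(u in side X x) (drop_csize X u)%:E <=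
   \esum_(u in side Z x) (drop_csize Z u)%:E)%E.
Proof.
move=> symX XE symZ ZX Ax; have ZE := subset_trans ZX XE.
have [xh|xh] := pselect (component X x (h x)).
  rewrite loss_same//; apply: esum_ge0 => u _.
  by rewrite lee_fin drop_csize_ge0.
have zh : ~ component Z x (h x) by move=> /(component_sub ZX).
rewrite !loss_distinct//.
set n := (_ + _)%N; set m := (_ + _)%N; rewrite lee_fin lerD2l lerN2.
have mn : (m <= n)%N.
  by apply: leq_add; apply: csize_mono; exact: component_sub.
have m0 : (0 < m)%N.
  by rewrite addn_gt0; apply/orP; left; apply: csize_gt0 k0 _; exact: component_refl.
have n0 : (0 < n)%N by lia.
rewrite ler_pdivrMr ?ltr0n ?leq_min ?m0//.
rewrite mulrAC ler_pdivlMr ?ltr0n ?leq_min ?n0// -!natrM ler_nat.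
have [mk|km] := leqP m k; have [nk|kn] := leqP n k; nia.
Qed.

End matching_loss.

(** * Submodularity *)

HB.lock Definition mean {d : measure_display} {T : measurableType d}
  {R : realType} (lambda : probability T R) (f : T -> R) : R :=
  fine (\int[lambda]_u (f u)%:E).

(** * Expectations of functions with values between 0 and 1 *)

Section unit_mean.
Context (d : measure_display) (T : measurableType d) (R : realType).
Variable lambda : probability T R.
Implicit Types f : T -> R.
Local Notation mean := (mean lambda).

Definition unit_fun f := measurable_fun setT f /\ forall u, 0 <= f u <= 1.

Lemma unit_fun_ge0 f u : unit_fun f -> (0 <= (f u)%:E)%E.
Proof. by move=> [_ /(_ u)/andP[f0 _]]; rewrite lee_fin. Qed.

Lemma unit_fun_measurable f : unit_fun f -> measurable_fun setT (EFin \o f).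
Proof. by move=> [mf _]; exact/measurable_EFinP. Qed.

Lemma integral_cst_probability (c : R) : (\int[lambda]_u c%:E = c%:E)%E.
Proof.
rewrite integral_cst// (_ : _ setT = 1%E) ?mule1//; exact: probability_setT.
Qed.

Lemma integral_le_unit f : unit_fun f -> (\int[lambda]_u (f u)%:E <= 1)%E.
Proof.
move=> uf; have -> : (1 = \int[lambda]_u (1 : R)%:E)%E.
  by rewrite integral_cst_probability.
apply: ge0_le_integral => //.
- by move=> u _; exact: unit_fun_ge0.
- exact: unit_fun_measurable.
- by move=> u _; rewrite lee_fin; have [_ /(_ u)/andP[]] := uf.
Qed.

Lemma meanE f : unit_fun f -> (mean f)%:E = (\int[lambda]_u (f u)%:E)%E.
Proof.
move=> uf; rewrite mean.unlock fineK// ge0_fin_numE.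
  by apply: le_lt_trans (integral_le_unit uf) _; rewrite ltry.
by apply: integral_ge0 => u _; exact: unit_fun_ge0.
Qed.

Lemma mean_le f f' : unit_fun f -> unit_fun f' -> (forall u, f u <= f' u) ->
  mean f <= mean f'.
Proof.
move=> uf uf' ff'; rewrite -lee_fin !meanE//; apply: ge0_le_integral => //.
- by move=> u _; exact: unit_fun_ge0.
- exact: unit_fun_measurable.
- exact: unit_fun_measurable.
- by move=> u _; rewrite lee_fin.
Qed.

Lemma mean_le1 f : unit_fun f -> mean f <= 1.
Proof. by move=> uf; rewrite -lee_fin meanE//; exact: integral_le_unit. Qed.

Lemma mean_le_cst f f' (c : R) : unit_fun f -> unit_fun f' -> 0 <= c ->
  (forall u, f u <= f' u + c) -> mean f <= mean f' + c.
Proof.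
move=> uf uf' c0 ff'; rewrite -lee_fin EFinD !meanE//.
have -> : (c%:E = \int[lambda]_u c%:E)%E.
  by rewrite integral_cst_probability.
rewrite -ge0_integralD//; last 2 first.
- by move=> u _; exact: unit_fun_ge0.
- exact: unit_fun_measurable.
apply: ge0_le_integral => //.
- by move=> u _; exact: unit_fun_ge0.
- exact: unit_fun_measurable.
- by apply: emeasurable_funD => //; exact: unit_fun_measurable.
- by move=> u _; rewrite -EFinD lee_fin.
Qed.

(** Dominated convergence with the constant bound [1]. Truncated sizes are integers, so they
    converge by becoming eventually constant. *)
Lemma mean_cvg_le (f_ : (T -> R)^nat) f (c : R) : (forall n, unit_fun (f_ n)) ->
  unit_fun f -> (forall u, exists N, forall n, (N <= n)%N -> f_ n u = f u) ->
  (forall n, c <= mean (f_ n)) -> c <= mean f.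
Proof.
move=> uf_ uf f_f cf; have [] := @dominated_convergence _ _ _ lambda setT measurableT
  (fun n u => (f_ n u)%:E) (EFin \o f) (cst 1%E).
- by move=> n; exact: unit_fun_measurable.
- exact: unit_fun_measurable.
- apply: aeW => u _; have [N fN] := f_f u; apply: cvg_near_cst.
  by exists N => // n /= Nn; rewrite fN.
- exact: finite_measure_integrable_cst.
- apply: aeW => u n _; rewrite gee0_abs; last exact: unit_fun_ge0.
  by rewrite lee_fin; have [_ /(_ u)/andP[]] := uf_ n.
move=> _ _ /= cvgf; rewrite -lee_fin meanE//.
rewrite -(cvg_lim (@ereal_hausdorff R) cvgf); apply: lime_ge.
  by apply/cvg_ex; eexists; exact: cvgf.
by apply: nearW => n; rewrite -meanE// lee_fin.
Qed.

End unit_mean.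

(** * Supermodularity of the expected truncated reciprocal size *)

Section supermodular_inv_csize.
Context (d : measure_display) (J : measurableType d) (R : realType).
Variables (lambda : probability J R) (E : set (J * J)).
Variable (g : nat -> J -> J).
Hypothesis mdiag : measurable [set p : J * J | p.1 = p.2].
Hypothesis mE : measurable E.
Hypothesis symE : symmetric_set E.
Hypothesis mg : forall n, measurable_fun setT (g n).
Hypothesis Eg : forall x y, E (x, y) -> exists n, y = g n x.
Variable P : nat -> piso lambda.
Hypothesis PE : forall u v, component E u v <->
  exists n, dom (P n) u /\ fw (P n) u = v.
Hypothesis Puniq : forall u n m, dom (P n) u -> dom (P m) u ->
  fw (P n) u = fw (P m) u -> n = m.
Variable k : nat.
Hypothesis k0 : (0 < k)%N.
Implicit Types X Y Z : set (J * J).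

Notation ics := (@inv_csize J R k).

Lemma unit_inv_csize X : measurable X -> X `<=` E -> unit_fun (ics X).
Proof.
move=> mX XE; split.
  pose f (s : option nat) : R := (if s is Some n then minn n k else k)%:R^-1.
  exact: (measurable_fun_osize mdiag mg Eg PE Puniq f mX XE).
move=> u; rewrite invr_ge0 ler0n /= invf_le1 ?ler1n ?ltr0n;
  by apply: csize_gt0 k0 _; exact: component_refl.
Qed.

Section one_matching.
Variables (A : set J) (h : J -> J).
Hypothesis mA : measurable A.
Hypothesis mh : measurable_fun setT h.
Hypothesis AE : forall x, A x -> E (x, h x).
Hypothesis sepA : forall x x' l, A x -> A x' -> (l <= k.+2)%N ->
  walk E l x x' -> x = x'.

Notation M := (matching A h).
Notation drop := (drop_csize R k A h).

Lemma measurable_matching : measurable M.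
Proof.
have mfst := @measurable_fst _ _ J J; have msnd := @measurable_snd _ _ J J.
have mhf : measurable_fun setT (fun p : J * J => h p.1) by exact: measurableT_comp.
have mhs : measurable_fun setT (fun p : J * J => h p.2) by exact: measurableT_comp.
apply: measurable_disj; apply: measurable_conj.
- exact: (measurable_preimage mfst mA).
- exact: (measurable_preimage (measurable_fun_pair msnd mhf) mdiag).
- exact: (measurable_preimage msnd mA).
- exact: (measurable_preimage (measurable_fun_pair mfst mhs) mdiag).
Qed.

Section one_edge_set.
Variable X : set (J * J).
Hypothesis mX : measurable X.
Hypothesis symX : symmetric_set X.
Hypothesis XE : X `<=` E.

Let XME : X `|` M `<=` E.
Proof. by rewrite subUset; split => //; exact: matching_sub. Qed.

Let mXM : measurable (X `|` M).
Proof. by apply: measurableU => //; exact: measurable_matching. Qed.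

Lemma unit_drop : unit_fun (drop X).
Proof.
split; first by apply: measurable_funB; [exact: (unit_inv_csize mX XE).1|
  exact: (unit_inv_csize mXM XME).1].
move=> u; rewrite drop_csize_ge0//=.
have [_ /(_ u)/andP[_ u1]] := unit_inv_csize mX XE.
have [_ /(_ u)/andP[u0 _]] := unit_inv_csize mXM XME.
by rewrite /drop_csize lerBlDr; apply: le_trans u1 _; rewrite lerDl.
Qed.

Lemma mean_drop : mean lambda (ics X) =
  mean lambda (ics (X `|` M)) + mean lambda (drop X).
Proof.
have uX := unit_inv_csize mX XE; have uW := unit_inv_csize mXM XME.
apply: EFin_inj; rewrite EFinD (meanE _ uX) (meanE _ uW) (meanE _ unit_drop).
rewrite -ge0_integralD//.
- by apply: eq_integral => u _; rewrite -EFinD /drop_csize addrC subrK.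
- by move=> u _; apply: unit_fun_ge0; exact: unit_inv_csize.
- by apply: unit_fun_measurable; exact: unit_inv_csize.
- by move=> u _; apply: unit_fun_ge0; exact: unit_drop.
- by apply: unit_fun_measurable; exact: unit_drop.
Qed.

(** The transported mass: the point [p.1] of [A] is charged with the drop at [p.2]. *)
Let F (p : J * J) : \bar R :=
  if `[< A p.1 /\ side h X p.1 p.2 >] then (drop X p.2)%:E else 0%E.

Let F0 p : (0 <= F p)%E.
Proof. by rewrite /F; case: ifP => // _; rewrite lee_fin drop_csize_ge0. Qed.

Let mF : measurable_fun setT F.
Proof.
pose S := [set p : J * J | A p.1 /\ side h X p.1 p.2].
have mC : measurable [set p : J * J | component X p.1 p.2].
  exact: (measurable_component mdiag mg Eg).
have mhp : measurable_fun setT (fun p : J * J => (h p.1, p.2)).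
  apply: measurable_fun_pair; last exact: measurable_snd.
  by apply: measurableT_comp => //; exact: measurable_fst.
have mS : measurable S.
  apply: measurable_conj; first exact: (measurable_preimage (@measurable_fst _ _ J J)).
  apply: measurable_disj => //; exact: (measurable_preimage mhp mC).
rewrite (_ : F = (fun p => if p \in S then (drop X p.2)%:E else 0%E)).
  apply: measurable_fun_ifT; [exact: measurable_mem| |exact: measurable_cst].
  have mD : measurable_fun setT (fun u => (drop X u)%:E).
    by apply: unit_fun_measurable; exact: unit_drop.
  exact: measurableT_comp mD (@measurable_snd _ _ J J).
apply/funext => p; rewrite /F; congr (if _ then _ else _).
Qed.

Definition loss x := (\esum_(u in [set u | component E x u])
  (if `[< A x /\ side h X x u >] then (drop X u)%:E else 0))%E.

Lemma measurable_loss : measurable_fun setT loss.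
Proof.
exact: (measurable_esum_section (P := P) (K := [set p | component E p.1 p.2])
  PE Puniq mF F0).
Qed.

Lemma loss_ge0 x : (0 <= loss x)%E.
Proof. by apply: esum_ge0 => u _; exact: (F0 (x, u)). Qed.

(** Mass transport turns the expected drop at a vertex into the expected loss at a point of [A],
    where different edge sets can be compared edge by edge. *)
Lemma mean_drop_loss : ((mean lambda (drop X))%:E = \int[lambda]_x loss x)%E.
Proof.
rewrite meanE; last exact: unit_drop.
rewrite /loss (mass_transport (P := P) (K := [set p | component E p.1 p.2])
  PE Puniq mF F0).
by apply: eq_integral => u _; rewrite -(esum_drop_csize_side R symE k0 AE sepA symX XE).
Qed.

Lemma loss_in x : A x ->
  (loss x = \esum_(u in side h X x) (drop X u)%:E)%E.
Proof.
move=> Ax; rewrite /loss; transitivity (\esum_(u in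
    [set u | component E x u] `&` side h X x) (drop X u)%:E)%E.
  rewrite esum_mkcondr; apply: eq_esum => u _; congr (if _ then _ else _).
  by apply/asboolP/idP; rewrite inE => //; case.
congr esum; apply/seteqP; split => u /= => [[]//|xu]; split => //.
case: xu => /(component_sub XE)//; apply: component_trans.
exact/component_edge/AE.
Qed.

Lemma loss_out x : ~ A x -> loss x = 0%E.
Proof. by move=> Ax; apply: esum1 => u _; rewrite asboolF// => -[]. Qed.

End one_edge_set.

(** Rearranged, the matching causes a smaller expected drop on [X] than on [Z]; [loss_anti] gives
    this pointwise after mass transport. *)
Lemma mean_matching X Z : measurable X -> symmetric_set X -> X `<=` E ->
  measurable Z -> symmetric_set Z -> Z `<=` X ->
  mean lambda (ics X) + mean lambda (ics (Z `|` M)) <=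
  mean lambda (ics (X `|` M)) + mean lambda (ics Z).
Proof.
move=> mX symX XE mZ symZ ZX; have ZE := subset_trans ZX XE.
rewrite (mean_drop mX XE) (mean_drop mZ ZE) -addrA lerD2l addrC lerD2l.
rewrite -lee_fin (mean_drop_loss mX symX XE) (mean_drop_loss mZ symZ ZE).
apply: ge0_le_integral => //.
- by move=> x _; exact: loss_ge0.
- exact: measurable_loss.
- exact: measurable_loss.
- move=> x _; have [Ax|nAx] := pselect (A x); last by rewrite !loss_out.
  by rewrite !loss_in//; exact: (loss_anti R symE k0 AE sepA symX XE symZ ZX).
Qed.

End one_matching.

Context (cl : nat -> J -> J -> Prop) (q : nat -> J) (Q : polish cl q).
Hypothesis finE : forall x, finite_set [set y | E (x, y)].

(** [mean_matching] is iterated along matchings that exhaust [Y], added to [X] and to the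
    intersection [Z]. The sets [U n X] increase to the union, where a limit is taken; the sets
    [U n Z] stay inside [Y], so monotonicity bounds their mean from below. *)
Lemma inv_csize_supermodular X Y : measurable X -> symmetric_set X -> X `<=` E ->
  measurable Y -> symmetric_set Y -> Y `<=` E ->
  mean lambda (ics X) + mean lambda (ics Y) <=
  mean lambda (ics (X `|` Y)) + mean lambda (ics (X `&` Y)).
Proof.
move=> mX symX XE mY symY YE.
have [A [h [mA mh sepA Ah]]] :=
  @separated_cover _ _ _ _ _ _ mdiag mg Eg P PE _ _ Q mE finE k.+2.
pose B n := [set x | A n x /\ Y (x, h n x)].
have mB n : measurable (B n).
  apply: measurable_conj; first exact: mA.
  exact: (measurable_preimage (measurable_fun_pair (@measurable_id _ J setT) (mh n)) mY).
have BE n x : B n x -> E (x, h n x) by move=> [_ /YE].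
have sepB n x x' l : B n x -> B n x' -> (l <= k.+2)%N -> walk E l x x' -> x = x'.
  by move=> [Ax _] [Ax' _]; exact: sepA Ax Ax'.
pose N n := matching (B n) (h n).
have NY n : N n `<=` Y.
  by move=> [x y] [/= [[_ xY] ->]//|/= [[_ yY] ->]]; exact: symY.
pose U n Z := iteri n (fun i V => V `|` N i) Z.
have US n Z : U n.+1 Z = U n Z `|` N n by [].
have mU n Z : measurable Z -> measurable (U n Z).
  move=> mZ; elim: n => // n IH; rewrite US; apply: measurableU => //.
  exact: measurable_matching.
have symU n Z : symmetric_set Z -> symmetric_set (U n Z).
  move=> sZ; elim: n => // n IH x y; rewrite US => -[/IH|]; first by left.
  by move=> xy; right; exact: (matching_sym xy).
have US_sub n Z V : Z `<=` V -> Y `<=` V -> U n Z `<=` V.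
  move=> ZV YV; elim: n => // n IH; rewrite US subUset; split => //.
  exact: subset_trans (NY n) YV.
have U_mono n Z V : Z `<=` V -> U n Z `<=` U n V.
  by move=> ZV; elim: n => // n IH; rewrite !US; exact: setSU.
pose Z := X `&` Y.
have mZ : measurable Z by exact: measurableI.
have symZ : symmetric_set Z by move=> x y [/symX xy /symY yx].
have ZX : Z `<=` X by exact: subIsetl.
have ZY : Z `<=` Y by exact: subIsetr.
have step n : mean lambda (ics X) + mean lambda (ics (U n Z)) <=
    mean lambda (ics (U n X)) + mean lambda (ics Z).
  elim: n => [|n IH]; first exact: lexx.
  have := mean_matching (mB n) (mh n) (@BE n) (@sepB n) (mU n _ mX) (symU n _ symX)
    (US_sub n _ _ XE YE) (mU n _ mZ) (symU n _ symZ) (U_mono n _ _ ZX).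
  rewrite -!US; lra.
have UX : \bigcup_n U n X = X `|` Y.
  apply/seteqP; split => [p [n _]|p [Xp|Yp]].
  - by apply: US_sub; [exact: subsetUl|exact: subsetUr].
  - by exists 0%N.
  - case: p Yp => x y Yxy; have [n [An yh]] := Ah _ _ (YE _ Yxy).
    by exists n.+1 => //; rewrite US; right; left; split => //; split => //; rewrite -yh.
have XYE : X `|` Y `<=` E by rewrite subUset.
rewrite -lerBlDr; apply: (mean_cvg_le (f_ := fun n => ics (U n X))).
- by move=> n; apply: unit_inv_csize; [exact: mU|exact: US_sub].
- by apply: unit_inv_csize => //; exact: measurableU.
(* At a fixed vertex the component in the union is the increasing union of the components in
   [U n X], so its truncated size is attained at a finite stage. *)
- move=> u; have Und n : U n X `<=` U n.+1 X by rewrite US; exact: subsetUl.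
  have [n nP] := @csize_bigcup _ k (fun n => component (U n X) u)
    (fun n => @component_sub _ _ _ u (Und n)).
  exists n => m /nP; rewrite /inv_csize => ->; congr (_%:R^-1); congr csize.
  rewrite -UX; apply/seteqP; split => v; last first.
    by move=> /(component_bigcup Und)[l uv]; exists l.
  by move=> [l _]; apply: component_sub => p Up; exists l.
move=> n; rewrite lerBlDr; apply: le_trans (step n); rewrite lerD2l.
apply: mean_le.
- exact: unit_inv_csize.
- by apply: unit_inv_csize; [exact: mU|apply: US_sub => //; exact: subset_trans ZX XE].
- by move=> u; apply: inv_csize_anti => //; exact: US_sub.
Qed.

End supermodular_inv_csize.

Lemma ler_addinvn (R : realType) (x y : R) :
  (forall k, (0 < k)%N -> x <= y + k%:R^-1) -> x <= y.
Proof.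
move=> H; apply/ler_addgt0Pr => e e0; pose k := (Num.truncn e^-1).+1.
apply: le_trans (H k isT) _; rewrite lerD2l invf_ple ?posrE ?ltr0n//.
exact/ltW/truncnS_gt.
Qed.

(** * The reciprocal size of a component *)

Section inv_size.
Context (J : choiceType) (R : realType).
Implicit Types X Y : set (J * J).

Definition inv_size X u : R :=
  if osize (component X u) is Some n then n%:R^-1 else 0.

Lemma inv_size_counting X u :
  fine ((counting (component X u) : \bar R)^-1)%E = inv_size X u.
Proof.
rewrite /inv_size /osize /counting; case: asboolP => _; last by rewrite /inve.
by rewrite /inve; case: ifPn => [/eqP ->|//]; rewrite invr0.
Qed.

(** Truncation alters the reciprocal only where it is below [1/k], and replaces it there by
    [1/k]. *)
Lemma inv_size_le_inv_csize k X u : (0 < k)%N ->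
  inv_size X u <= inv_csize R k X u <= inv_size X u + k%:R^-1.
Proof.
move=> k0; have c0 : (0 < csize k (component X u))%N.
  by apply: csize_gt0 k0 _; exact: component_refl.
move: c0; rewrite /inv_size /inv_csize /csize; case: osize => [n|_]; last first.
  by rewrite add0r lexx andbT invr_ge0 ler0n.
have [nk n0|kn _] := leqP n k; first by rewrite lexx lerDl invr_ge0 ler0n.
rewrite lef_pV2 ?posrE ?ltr0n//; last exact: ltn_trans kn.
by rewrite ler_nat ltnW// lerDr invr_ge0 ler0n.
Qed.

Lemma inv_size_anti X Y u : X `<=` Y -> inv_size Y u <= inv_size X u.
Proof.
move=> XY; apply: ler_addinvn => k k0.
have /andP[Yle _] := inv_size_le_inv_csize Y u k0.
have /andP[_ Xle] := inv_size_le_inv_csize X u k0.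
by apply: le_trans Yle _; apply: le_trans Xle; exact: inv_csize_anti.
Qed.

Lemma inv_size_isolated X u : (forall v, ~ X (u, v)) -> inv_size X u = 1.
Proof.
move=> Xu; rewrite /inv_size (_ : component X u = [set u]).
  rewrite /osize asboolT; last exact: finite_set1.
  by rewrite fset_set1 cardfs1 invr1.
apply/seteqP; split => v /=; last by move=> ->; exact: component_refl.
by apply: (@component_closed _ X [set u]) => // x y -> /Xu.
Qed.

End inv_size.

Lemma rhoE (R : realType) (d : measure_display) (J : measurableType d)
    (lambda : probability J R) (X : set (J * J)) :
  rho lambda X = 1 - mean lambda (inv_size R X).
Proof.
rewrite /rho unlock mean.unlock; congr (1 - fine _); apply: eq_integral => u _.
by rewrite inv_size_counting.
Qed.

(** * Monotonicity, support bound and submodularity of [rho] *)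

Section rho_properties.
Context (d : measure_display) (J : measurableType d) (R : realType).
Variables (lambda : probability J R) (E : set (J * J)).
Variable (g : nat -> J -> J).
Hypothesis mdiag : measurable [set p : J * J | p.1 = p.2].
Hypothesis mE : measurable E.
Hypothesis symE : symmetric_set E.
Hypothesis mg : forall n, measurable_fun setT (g n).
Hypothesis Eg : forall x y, E (x, y) -> exists n, y = g n x.
Variable P : nat -> piso lambda.
Hypothesis PE : forall u v, component E u v <->
  exists n, dom (P n) u /\ fw (P n) u = v.
Hypothesis Puniq : forall u n m, dom (P n) u -> dom (P m) u ->
  fw (P n) u = fw (P m) u -> n = m.
Implicit Types X Y Z : set (J * J).

Lemma unit_inv_size X : measurable X -> X `<=` E -> unit_fun (inv_size R X).
Proof.
move=> mX XE; split.
  pose f (s : option nat) : R := if s is Some n then n%:R^-1 else 0.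
  exact: (measurable_fun_osize mdiag mg Eg PE Puniq f mX XE).
move=> u; rewrite /inv_size; case: osize => [n|]; last by rewrite lexx ler01.
rewrite invr_ge0 ler0n /=; case: n => [|n]; first by rewrite invr0.
by rewrite invf_le1 ?ler1n ?ltr0n.
Qed.

Lemma rho_ge0 X : measurable X -> X `<=` E -> 0 <= rho lambda X.
Proof.
by move=> mX XE; rewrite rhoE subr_ge0; apply: mean_le1; exact: unit_inv_size.
Qed.

Lemma rho_increasing : increasing_on (borel_edge_sets E) (rho lambda).
Proof.
move=> X Y [mX XE _] [mY YE _] XY; rewrite !rhoE lerD2l lerN2.
by apply: mean_le; [exact: unit_inv_size|exact: unit_inv_size|
  move=> u; exact: inv_size_anti].
Qed.

(** An isolated vertex is its whole component and contributes [1] to the expectation, which is thus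
    at least the measure of the isolated vertices. *)
Lemma rho_le_support X : measurable X -> X `<=` E ->
  measurable [set u | exists v, X (u, v)] ->
  rho lambda X <= fine (lambda [set u | exists v, X (u, v)]).
Proof.
move=> mX XE; set S := [set u | _] => mS.
have mSC : measurable (~` S) by exact: measurableC.
have uS : unit_fun (\1_(~` S) : J -> R).
  split; first exact: measurable_indic.
  by move=> u; rewrite indicE; case: (_ \in _); rewrite ?ler01 ?lexx.
have -> : fine (lambda S) = 1 - mean lambda (\1_(~` S)).
  rewrite mean.unlock; have -> : (\int[lambda]_u (\1_(~` S) u)%:E = 1 - lambda S)%E.
    by rewrite integral_indic// setIT; exact: probability_setC.
  by rewrite fineB ?fin_num_measure//= opprB addrC subrK.
rewrite rhoE lerD2l lerN2; apply: mean_le => //; first exact: unit_inv_size.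
move=> u; rewrite indicE; case: (boolP (u \in ~` S)) => [|_].
  rewrite inE /S /= => Xu; rewrite inv_size_isolated// => v Xuv.
  by apply: Xu; exists v.
by have [_ /(_ u)/andP[]] := unit_inv_size mX XE.
Qed.

Section submodularity.
Context (cl : nat -> J -> J -> Prop) (q : nat -> J) (Q : polish cl q).
Hypothesis finE : forall x, finite_set [set y | E (x, y)].

Lemma rho_submodular : submodular_on (borel_edge_sets E) (rho lambda).
Proof.
move=> X Y [mX XE symX] [mY YE symY].
have mU : measurable (X `|` Y) by exact: measurableU.
have mI : measurable (X `&` Y) by exact: measurableI.
have UE : X `|` Y `<=` E by rewrite subUset.
have IE : X `&` Y `<=` E by move=> p [/XE].
rewrite !rhoE.
suff : mean lambda (inv_size R X) + mean lambda (inv_size R Y) <=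
  mean lambda (inv_size R (X `|` Y)) + mean lambda (inv_size R (X `&` Y)) by lra.
(* Each of the two terms on the right costs an error [1/k] under truncation; halving makes the total
   error exactly [1/k]. *)
suff : (mean lambda (inv_size R X) + mean lambda (inv_size R Y)) / 2 <=
  (mean lambda (inv_size R (X `|` Y)) + mean lambda (inv_size R (X `&` Y))) / 2.
  by lra.
apply: ler_addinvn => k k0.
have H := inv_csize_supermodular mdiag mE symE mg Eg PE Puniq k0 Q finE
  mX symX XE mY symY YE.
have lo Z : measurable Z -> Z `<=` E ->
    mean lambda (inv_size R Z) <= mean lambda (inv_csize R k Z).
  move=> mZ ZE; apply: mean_le; first exact: unit_inv_size.
    exact: (unit_inv_csize mdiag mg Eg PE Puniq k0).
  by move=> u; have /andP[] := inv_size_le_inv_csize R Z u k0.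
have up Z : measurable Z -> Z `<=` E ->
    mean lambda (inv_csize R k Z) <= mean lambda (inv_size R Z) + k%:R^-1.
  move=> mZ ZE; apply: mean_le_cst.
  - exact: (unit_inv_csize mdiag mg Eg PE Puniq k0).
  - exact: unit_inv_size.
  - by rewrite invr_ge0 ler0n.
  - by move=> u; have /andP[] := inv_size_le_inv_csize R Z u k0.
have := lo _ mX XE; have := lo _ mY YE; have := up _ mU UE; have := up _ mI IE.
by lra.
Qed.

End submodularity.

End rho_properties.

(** * Boundedness and continuity from domination by a finite measure *)

Section continuity.
Context (d : measure_display) (T : measurableType d) (R : realType).
Variables (eta : probability T R) (F : set (set T)) (phi : set T -> R) (c : R).
Hypothesis c0 : 0 < c.
Hypothesis mF : forall X, F X -> measurable X.
Hypothesis FD : forall X Y, F X -> F Y -> F (X `\` Y).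
Hypothesis F_bigcap : forall A : nat -> set T, (forall n, F (A n)) ->
  F (\bigcap_n A n).
Hypothesis phi_incr : increasing_on F phi.
Hypothesis phi_sub : submodular_on F phi.
Hypothesis phi_ge0 : forall X, F X -> 0 <= phi X.
Hypothesis phi_le : forall X, F X -> ((phi X)%:E <= c%:E * eta X)%E.

Lemma strongly_bounded_of_le : strongly_bounded_on F phi.
Proof.
exists (mscale (NngNum (ltW c0)) eta); exact: phi_le.
Qed.

Lemma absolutely_continuous_of_le : absolutely_continuous_on F phi eta.
Proof.
move=> eps eps0; exists (eps / c); first exact: divr_gt0.
move=> S FS Sd; rewrite ger0_norm ?phi_ge0// -lte_fin.
apply: le_lt_trans (phi_le FS) _.
by rewrite muleC -lte_pdivlMr// -EFinM.
Qed.

(** Submodularity for [B] and the difference of [A n] and [B] bounds [phi (A n)] by [phi B] plus [c]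
    times the measure of this difference. The differences decrease to the empty set, and [phi (A n)]
    is squeezed. *)
Lemma continuous_from_above_of_le : continuous_from_above_on F phi.
Proof.
move=> A FA Adecr; set B := \bigcap_n A n.
have FB : F B by exact: F_bigcap.
have BA n : B `<=` A n by move=> x; exact.
have Ale m n : (m <= n)%N -> A n `<=` A m.
  by move=> /subnKC <-; elim: (n - m)%N => [|l IH]; rewrite ?addn0// addnS;
    exact: subset_trans (Adecr _) _.
have FAB n : F (A n `\` B) by exact: FD.
have F0 : F set0 by rewrite -(setDv B); exact: FD.
have le n : phi (A n) <= phi B + c * fine (eta (A n `\` B)).
  have := phi_sub FB (FAB n); rewrite (setDUK (BA n)) setDIK => H.
  have := phi_ge0 F0; have := phi_le (FAB n).
  rewrite -[eta _]fineK; last by apply: fin_num_measure; exact: mF.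
  by rewrite -EFinM lee_fin; lra.
have cvg0 : fine (eta (A n `\` B)) @[n --> \oo] --> (0 : R).
  apply: fine_cvg; rewrite (_ : 0%:E = eta (\bigcap_n (A n `\` B))).
    apply: (@nonincreasing_cvg_mu _ _ _ eta (fun n => A n `\` B)).
    - by apply: le_lt_trans (probability_le1 _ _) _; [exact: mF|rewrite ltry].
    - by move=> n; exact: mF.
    - by apply: bigcapT_measurable => n; exact: mF.
    - by move=> m n /Ale mn; apply/subsetPset; exact: setSD.
  rewrite (_ : \bigcap_n _ = set0) ?measure0//.
  apply/seteqP; split => // x xAB; have [_] := xAB 0%N I; apply => n _.
  by have [] := xAB n I.
apply: (@squeeze_cvgr _ _ _ _ (cst (phi B)) (fun n => phi B + c * fine (eta (A n `\` B)))).
- by apply: nearW => n; rewrite le andbT; exact: phi_incr (BA n).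
- exact: cvg_cst.
- rewrite -[X in _ --> X]addr0 -[X in _ --> _ + X](mulr0 c).
  by apply: cvgD; [exact: cvg_cst|apply: cvgM => //; exact: cvg_cst].
Qed.

End continuity.

(** The empty space cannot carry total mass [1]. The point obtained serves as default value in the
    dense sequence. *)
Lemma probability_point (d : measure_display) (J : measurableType d)
    (R : realType) (lambda : probability J R) : inhabited J.
Proof.
apply: contrapT => nJ; have := @probability_setT _ _ _ lambda.
rewrite (_ : setT = set0); last by apply/seteqP; split => // x _; case: nJ.
rewrite measure0 => /eqP; rewrite eq_sym; exact/negP/oner_neq0.
Qed.

Section borel_edge_sets_closure.
Context (d : measure_display) (J : measurableType d) (E : set (J * J)).

Lemma borel_edge_setsD X Y : borel_edge_sets E X -> borel_edge_sets E Y ->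
  borel_edge_sets E (X `\` Y).
Proof.
move=> [mX XE symX] [mY _ symY]; split; first exact: measurableD.
- by move=> p [/XE].
- by move=> x y [/symX yx nY]; split => // /symY.
Qed.

Lemma borel_edge_sets_bigcap (A : nat -> set (J * J)) :
  (forall n, borel_edge_sets E (A n)) -> borel_edge_sets E (\bigcap_n A n).
Proof.
move=> FA; split.
- by apply: bigcapT_measurable => n; have [] := FA n.
- by move=> p /(_ 0%N I); have [_ AE _] := FA 0%N; exact: AE.
- by move=> x y Axy n _; have [_ _ sA] := FA n; apply/sA/Axy.
Qed.

End borel_edge_sets_closure.

Theorem theorem4p3 (R : realType) (d : measure_display) (J : measurableType d)
    (lambda : probability J R) (E : set (J * J))
    (eta : probability (J * J)%type R)
    (hG : graphing lambda E)
    (hd : (0 < average_degree lambda E)%E)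
    (heta : edge_measure lambda E eta) :
  increasing_on (borel_edge_sets E) (rho lambda) /\
  submodular_on (borel_edge_sets E) (rho lambda) /\
  strongly_bounded_on (borel_edge_sets E) (rho lambda) /\
  continuous_from_above_on (borel_edge_sets E) (rho lambda) /\
  absolutely_continuous_on (borel_edge_sets E) (rho lambda) eta.
Proof.
have [j0] := probability_point lambda.
case: hG => sbJ mE symE _ [D degD] mass_preserving.
have [cl [q Q]] := standard_borel_polish j0 sbJ.
have nbrE x : [set y | setT y /\ E (x, y)] = [set y | E (x, y)].
  by apply/seteqP; split => y /=; [case|].
have hD x (t : 'I_D.+1 -> J) : injective t -> ~ forall i, E (x, t i).
  apply: (@counting_le_inj R _ [set y | E (x, y)]).
  by rewrite -nbrE; exact: degD.
have finE x : finite_set [set y | E (x, y)].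
  by move: (degD x); rewrite /deg nbrE /counting; case: asboolP.
have [g mg Eg] := lusin_novikov_bounded Q mE hD.
have mdiag := measurable_diag Q.
have etaT : eta setT = 1%E by exact: probability_setT.
(* An infinite average degree would have inverse [0], and [eta] would vanish on the whole space. *)
have degfin : (average_degree lambda E < +oo)%E.
  rewrite ltey; apply/eqP => degoo; move: etaT.
  rewrite -setXTT heta// degoo /inve mul0e => /eqP.
  by rewrite eq_sym; exact/negP/oner_neq0.
have [P [PE Puniq]] := component_enumeration mE symE mdiag mg Eg mass_preserving degfin.
pose c := fine (average_degree lambda E).
have cE : (c%:E = average_degree lambda E)%E.
  by rewrite fineK// ge0_fin_numE// ltW.
have c0 : 0 < c by rewrite -lte_fin cE.
pose mass := edge_mass lambda mE mdiag mg.
(* The two finite measures agree on rectangles, hence everywhere; the bound through incident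
   vertices thereby becomes a bound by [eta]. *)
have massE Z : measurable Z -> mass Z = (c%:E * eta Z)%E.
  apply: (@measure_prod_unique _ _ _ mass (mscale (NngNum (ltW c0)) eta)).
    move=> A B mA mB; transitivity (c%:E * eta (A `*` B))%E; last by [].
    rewrite /mass (edge_massX _ _ _ _ Eg)// heta// -cE /inve gt_eqF// muleA.
    by rewrite -EFinM divff ?gt_eqF// mul1e.
  by rewrite /mass -setXTT (edge_massX _ _ _ _ Eg).
have rho_le X : borel_edge_sets E X -> ((rho lambda X)%:E <= c%:E * eta X)%E.
  move=> [mX XE symX]; rewrite -massE//.
  have [mS Smass] := edge_mass_ge_support lambda mE mdiag mg Eg mX XE.
  apply: le_trans Smass.
  rewrite -[leRHS]fineK ?fin_num_measure// lee_fin.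
  exact: (rho_le_support mdiag mg Eg PE Puniq).
have inc := rho_increasing mdiag mg Eg PE Puniq.
have sub := rho_submodular mdiag mE symE mg Eg PE Puniq Q finE.
have ge0 X : borel_edge_sets E X -> 0 <= rho lambda X.
  by move=> [mX XE _]; exact: (rho_ge0 mdiag mg Eg PE Puniq).
have mF X : borel_edge_sets E X -> measurable X by case.
have FD := @borel_edge_setsD _ _ E.
have Fcap := @borel_edge_sets_bigcap _ _ E.
split=> //; split=> //; split; first exact: (strongly_bounded_of_le c0 rho_le).
split; last exact: (absolutely_continuous_of_le c0 ge0 rho_le).
exact: (continuous_from_above_of_le mF FD Fcap inc sub ge0 rho_le).
Qed.
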